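(* Let $K$ be a field with a valuation $\mathrm{val}\colon K^*\to\mathbb R$ with value group $\Gamma$, admitting a group homomorphism $\Gamma\to K^*$, $\gamma\mapsto t^\gamma$, with $\mathrm{val}(t^\gamma)=\gamma$. Let $I=\langle f_1,\dots,f_l\rangle\subset K[x_1,\dots,x_n]$ be a homogeneous ideal generated by homogeneous polynomials $f_1,\dots,f_l$ with $\deg(f_i)\le d$ for $1\le i\le l$. Fix $w\in\mathbb R^n$. Then there is a Gröbner basis $\{g_1,\dots,g_s\}$ for $I$ with respect to $w$ with $$\deg(g_i)\le 2\left(\frac{d^2}{2}+d\right)^{2^{n-2}}\quad\text{for all } 1\le i\le s.$$
   Context: $R=\{a\in K:\mathrm{val}(a)\ge 0\}\cup\{0\}$ is the valuation ring, $\mathfrak m$ its maximal ideal, $\Bbbk=R/\mathfrak m$ the residue field, and $\overline a$ is the image of $a\in R$ in $\Bbbk$. For nonzero $f=\sum c_ux^u\in K[x_1,\dots,x_n]$ and $w\in\mathbb R^n$, let $W=\min\{\mathrm{val}(c_u)+w\cdot u: c_u\ne 0\}$ and $$\mathrm{in}_w(f)=\sum_{\mathrm{val}(c_u)+w\cdot u=W}\overline{t^{-\mathrm{val}(c_u)}c_u}\,x^u\in\Bbbk[x_1,\dots,x_n].$$ For a homogeneous ideal $I$, $\mathrm{in}_w(I)=\langle\mathrm{in}_w(f): f\in I\setminus\{0\}\rangle\subseteq\Bbbk[x_1,\dots,x_n]$. A finite set $\{g_1,\dots,g_s\}\subset I$ is a Gröbner basis for $I$ with respect to $w$ if $\mathrm{in}_w(I)=\langle\mathrm{in}_w(g_1),\dots,\mathrm{in}_w(g_s)\rangle$;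 throughout, Gröbner bases of homogeneous ideals consist of homogeneous polynomials. *)

(* Defs.v *)
From HB Require Import structures.
From mathcomp Require Import all_boot all_order all_algebra.
From mathcomp Require Import generic_quotient ring_quotient.
From mathcomp Require Import mpoly.
From mathcomp Require Import classical_sets reals exp.

Set Implicit Arguments.
Unset Strict Implicit.
Unset Printing Implicit Defensive.

Import Order.TTheory GRing.Theory Num.Theory.
Local Open Scope ring_scope.
Local Open Scope classical_set_scope.
Local Open Scope quotient_scope.

(* Only the values on K^* are meaningful: [val 0] is an arbitrary real. *)
Record valuation (R : realType) (K : fieldType) := Valuation {
  val_fun :> K -> R;
  valuationM : forall a b, a != 0 -> b != 0 ->
    val_fun (a * b) = val_fun a + val_fun b;
  valuationD : forall a b, a != 0 -> b != 0 -> a + b != 0 ->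
    Num.min (val_fun a) (val_fun b) <= val_fun (a + b) }.

Definition value_group (R : realType) (K : fieldType) (v : valuation R K) :
  set R := [set v a | a in [set a : K | a != 0]].

(* [t] represents a homomorphism from the value group to K^*; it is
   unconstrained outside the value group. *)
Record splitting (R : realType) (K : fieldType) (v : valuation R K)
    (t : R -> K) : Prop := Splitting {
  splitting_neq0 : forall g, value_group v g -> t g != 0;
  splittingD : forall g h, value_group v g -> value_group v h ->
    t (g + h) = t g * t h;
  splittingK : forall g, value_group v g -> v (t g) = g }.

Section ResidueField.
Variables (R : realType) (K : fieldType) (v : valuation R K).

Definition in_valring (a : K) : bool := (a == 0) || (0 <= v a).

Lemma val1 : v 1 = 0.
Proof.
have := valuationM v (oner_neq0 K) (oner_neq0 K).
by rewrite mulr1 => /esym/eqP; rewrite -subr_eq0 addrK => /eqP.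
Qed.

Lemma valN a : a != 0 -> v (- a) = v a.
Proof.
move=> a0; have n1 : (-1 : K) != 0 by rewrite oppr_eq0 oner_neq0.
rewrite -mulN1r valuationM //; suff -> : v (-1) = 0 by rewrite add0r.
have /eqP := valuationM v n1 n1.
by rewrite mulrNN mulr1 val1 eq_sym -mulr2n mulrn_eq0 /= => /eqP.
Qed.

Lemma in_valring_subring : subring_closed in_valring.
Proof.
split=> [|a b|a b]; rewrite !unfold_in /in_valring.
- by rewrite val1 lexx orbT.
- case: (eqVneq a 0) => [-> _|a0 /= va].
    case: (eqVneq b 0) => [->|b0 /= vb]; first by rewrite subr0 eqxx.
    by rewrite sub0r valN // vb orbT.
  case: (eqVneq b 0) => [-> _|b0 /= vb]; first by rewrite subr0 va orbT.
  case: (eqVneq (a - b) 0) => //= ab0.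
  have nb0 : - b != 0 by rewrite oppr_eq0.
  by apply: le_trans (valuationD v a0 nb0 ab0); rewrite le_min va valN.
- case: (eqVneq a 0) => [->|a0 /= va]; first by rewrite mul0r eqxx.
  case: (eqVneq b 0) => [->|b0 /= vb]; first by rewrite mulr0 eqxx.
  by rewrite valuationM // addr_ge0 // orbT.
Qed.

HB.instance Definition _ :=
  GRing.isSubringClosed.Build K in_valring in_valring_subring.

Record valring : predArgType :=
  ValRing { valring_val :> K; _ : valring_val \in in_valring }.

HB.instance Definition _ := [isSub for valring_val].
HB.instance Definition _ := [Choice of valring by <:].
HB.instance Definition _ := [SubChoice_isSubComNzRing of valring by <:].

Definition in_maxideal (a : valring) : bool :=
  (a == 0) || (0 < v (\val a)).

Lemma in_maxideal_idealr : idealr_closed in_maxideal.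
Proof.
have eq0 (x : valring) : (x == 0) = (\val x == 0) by [].
split=> [||a x y]; rewrite !unfold_in /in_maxideal ?eqxx //.
  by rewrite oner_eq0 /= val1 ltxx.
rewrite !eq0 rmorphD rmorphM /=.
have: valring_val a \in in_valring by exact: valP.
rewrite unfold_in /in_valring.
case: a x y => [a /= _] [x /= _] [y /= _].
case: (eqVneq a 0) => [->|a0 /= va]; first by rewrite mul0r add0r.
case: (eqVneq x 0) => [->|x0 /= vx]; first by rewrite mulr0 add0r.
have vax : 0 < v (a * x) by rewrite valuationM // ltr_wpDl.
case: (eqVneq y 0) => [->|y0 /= vy]; first by rewrite addr0 vax orbT.
case: (eqVneq (a * x + y) 0) => //= s0.
have ax0 : a * x != 0 by rewrite mulf_neq0.
by apply: lt_le_trans (valuationD v ax0 y0 s0); rewrite lt_min vax.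
Qed.

HB.instance Definition _ :=
  isIdealr.Build valring in_maxideal in_maxideal_idealr.

Lemma in_maxidealPn (a : valring) :
  reflect (exists b : valring, b * a = 1) (a \notin in_maxideal).
Proof.
have eq0 (x : valring) : (x == 0) = (\val x == 0) by [].
have := valP a; rewrite !unfold_in /in_valring /in_maxideal eq0 negb_or -leNgt.
move=> va; apply: (iffP andP) => [[a0 av]|[b ba]].
  have va0 : v (\val a) = 0.
    by move: va; rewrite (negPf a0) /= => va; apply/eqP; rewrite eq_le av va.
  have vi : v (\val a)^-1 = 0.
    have := valuationM v a0 (invr_neq0 a0).
    by rewrite mulfV // val1 va0 add0r.
  have iP : (\val a)^-1 \in in_valring.
    by rewrite unfold_in /in_valring vi lexx orbT.
  by exists (ValRing iP); apply: val_inj; rewrite rmorphM rmorph1 /= mulVf.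
have ba' : \val b * \val a = 1 by rewrite -rmorphM ba rmorph1.
have a0 : \val a != 0.
  by apply: contraTneq (oner_neq0 K) => a0; rewrite -ba' a0 mulr0 eqxx.
have b0 : \val b != 0.
  by apply: contraTneq (oner_neq0 K) => b0; rewrite -ba' b0 mul0r eqxx.
split=> //; have vb : 0 <= v (\val b).
  by have := valP b; rewrite unfold_in /in_valring (negPf b0).
have := valuationM v b0 a0; rewrite ba' val1 => /esym/eqP.
by rewrite addrC addr_eq0 => /eqP ->; rewrite oppr_le0.
Qed.

Definition maxideal : idealr valring := in_maxideal.

Definition residue_inv (x : {ideal_quot maxideal}) : {ideal_quot maxideal} :=
  \pi_({ideal_quot maxideal}) (insubd (0 : valring) (\val (repr x))^-1).

Lemma residue_eq0 (a : valring) :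
  (\pi_({ideal_quot maxideal}) a == 0) = (a \in in_maxideal).
Proof.
rewrite -[a in RHS]subr0 Quotient.idealrBE.
by have -> : \pi_({ideal_quot maxideal}) 0 = 0 by exact: pi_zeror.
Qed.

Lemma residue_mulVf (x : {ideal_quot maxideal}) : x != 0 -> residue_inv x * x = 1.
Proof.
move=> x0.
have xm : repr x \notin in_maxideal.
  by apply: contraNN x0; rewrite -residue_eq0 reprK.
have /in_maxidealPn[b ba] := xm.
rewrite /residue_inv.
have -> : (\val (repr x))^-1 = \val b.
  have ba' : \val b * \val (repr x) = 1 by rewrite -rmorphM ba rmorph1.
  have x'0 : \val (repr x) != 0.
    by apply: contraTneq (oner_neq0 K) => e; rewrite -ba' e mulr0 eqxx.
  by apply: (mulIf x'0); rewrite mulVf.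
rewrite valKd -[x in _ * x]reprK.
apply: etrans (esym (Quotient.pi_mul maxideal b (repr x))) _.
by rewrite ba; exact: pi_oner.
Qed.

Lemma residue_inv0 : residue_inv 0 = 0.
Proof.
rewrite /residue_inv; apply/eqP; rewrite residue_eq0.
have : repr (0 : {ideal_quot maxideal}) \in in_maxideal.
  by rewrite -residue_eq0 reprK.
move: (repr _) => a; rewrite !unfold_in /in_maxideal -!(inj_eq val_inj).
rewrite val_insubd rmorph0; case: ifP => [|_ _]; last by rewrite eqxx.
rewrite unfold_in /in_valring invr_eq0.
case: (eqVneq (\val a) 0) => [_ //|a0 /= vi va].
have := valuationM v a0 (invr_neq0 a0); rewrite mulfV // val1 => /eqP.
by rewrite eq_sym paddr_eq0 ?(ltW va) // gt_eqF.
Qed.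

Definition residue_field := {ideal_quot maxideal}.

HB.instance Definition _ := GRing.ComNzRing.on residue_field.
HB.instance Definition _ :=
  GRing.ComNzRing_isField.Build residue_field residue_mulVf residue_inv0.

(* The class of [a] modulo the maximal ideal; the class of [0] if [a] is not in
   the valuation ring. *)
Definition residue (a : K) : residue_field :=
  \pi_({ideal_quot maxideal}) (insubd (0 : valring) a).

End ResidueField.

Section Ideals.
Variable A : comNzRingType.

Definition ideal_gen (S : set A) : set A :=
  [set p | exists (m : nat) (a s : 'I_m -> A),
    (forall i, S (s i)) /\ p = \sum_(i < m) a i * s i].

End Ideals.

(* 0 for the zero polynomial *)
Definition mpdeg (n : nat) (K : fieldType) (f : {mpoly K[n]}) : nat :=
  (msize f).-1.

Section InitialForms.
Variables (R : realType) (K : fieldType) (v : valuation R K) (t : R -> K).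
Variables (n : nat) (w : 'rV[R]_n).

Definition weight (f : {mpoly K[n]}) (u : 'X_{1..n}) : R :=
  v f@_u + \sum_(i < n) w 0 i * (u i)%:R.

(* The minimum of the weights over the support of [f] (the base case of the
   iterated minimum is itself one of these weights); junk for [f = 0]. *)
Definition min_weight (f : {mpoly K[n]}) : R :=
  \big[Num.min/weight f (mlead f)]_(u <- msupp f) weight f u.

Definition initial_form (f : {mpoly K[n]}) : {mpoly (residue_field v)[n]} :=
  \sum_(u <- msupp f | weight f u == min_weight f)
    residue v (t (- v f@_u) * f@_u) *: 'X_[u].

Definition initial_ideal (I : set {mpoly K[n]}) :
    set {mpoly (residue_field v)[n]} :=
  ideal_gen [set initial_form f | f in [set f | I f /\ f != 0]].

(* The elements are required to be nonzero because initial forms are only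
   defined for nonzero polynomials, and homogeneous by the standing convention
   for homogeneous ideals. *)
Definition groebner_basis (I : set {mpoly K[n]}) (g : seq {mpoly K[n]}) : Prop :=
  (forall p, p \in g -> [/\ I p, p != 0 & p \is homog mdeg]) /\
  initial_ideal I = ideal_gen [set initial_form p | p in [set p | p \in g]].

End InitialForms.

(* Main.v *)
From HB Require Import structures.
Require Import Defs.
From mathcomp Require Import all_boot all_order all_algebra.
From mathcomp Require Import generic_quotient ring_quotient.
From mathcomp Require Import mpoly.
From mathcomp Require Import classical_sets reals exp.
From mathcomp Require Import boolp zify ring lra.

(* The Hilbert function of an ideal of K[x_1, ..., x_n] is a finite sum of shifted
   Hilbert functions of polynomial rings ("cones"), each recorded by its shift and
   its number of variables.  Following Dube, such a list is made "standard"
   (no gaps in degree) and then "exact" (one positive-dimensional cone per degree),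
   so that it is described by its Macaulay constants b_1 >= ... >= b_n.  This is
   done for the complement of an initial monomial ideal of in_w(I), with shifts
   from 0, where b_1 and the zero-dimensional cones control the degrees of the
   generators, and for I = <f_1> + (f_2) + ..., with shifts from d: adding f_i
   contributes a shifted copy of the Hilbert function of the quotient by
   (f_1, ..., f_{i-1}) : f_i.  Since in_w(I) and I have the same Hilbert function,
   the two functions add up to that of K[x_1, ..., x_n]; comparing iterated
   differences of the two polynomials bounds the sums a_i + b_i of Macaulay
   constants by descending induction on i.  Finally the zero-dimensional cones are
   invisible in the Hilbert polynomial, so they all lie in degrees below
   max(a_1, b_1). *)

Import Order.TTheory GRing.Theory Num.Theory.
Local Open Scope ring_scope.

Set Implicit Arguments.
Unset Strict Implicit.
Unset Printing Implicit Defensive.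

(** * Lists of cones and their Hilbert functions *)

Section ConeLists.
Local Open Scope nat_scope.

(** Only dimensions are followed: no cone is ever realised inside the ring, so lists of pairs
    suffice, and homogeneous ideals are handled as families of finite-dimensional components. The
    obstacle is that in_w(I) comes from weights and a valuation, not from a monomial order on
    K[x_1, ..., x_n]. Each component of I therefore gets a reduced echelon basis whose pivots are
    terms of minimal weight; the initial forms of such a basis are independent and span the initial
    component. This gives the equality of Hilbert functions and, in bounded degrees, the Groebner
    basis itself. With n = N + 1 variables, a single cone of full dimension occurs in I, that of a
    principal ideal moved to degree d; all other cones have at most N variables because they
    describe quotients by nonzero ideals or leftovers of a lift. Thus d enters twice, as the shift
    of that cone and as the starting degree of the rest, and the top sum is a_N + b_N = 2 d. Each
    step down in dimension squares the bound; the N - 1 steps from dimension N to dimension 1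
    produce the exponent 2^(n-2). *)

Definition cone_hilb (u z : nat) : nat :=
  if u is u'.+1 then 'C(z + u', u') else (z == 0).

(* A pair [c] stands for a cone h K[x_i, i in s] with h homogeneous of degree
   [c.1] and s a set of [c.2] variables. *)
Definition shifted_hilb (c : nat * nat) (z : nat) : nat :=
  if c.1 <= z then cone_hilb c.2 (z - c.1) else 0.

Definition hilb (P : seq (nat * nat)) (z : nat) : nat :=
  \sum_(c <- P) shifted_hilb c z.

(** Zero-dimensional cones are exempt and may sit in any degree; only the positive-dimensional ones
    must be linked to degree [q] without gaps. *)
Definition standard (q : nat) (P : seq (nat * nat)) : Prop :=
  forall c : nat * nat, c \in P -> 0 < c.2 -> q <= c.1 /\
  forall e, q <= e <= c.1 -> exists2 c' : nat * nat, c' \in P & c'.1 = e /\ c.2 <= c'.2.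

Lemma hilb_cons c P z : hilb (c :: P) z = shifted_hilb c z + hilb P z.
Proof. by rewrite /hilb big_cons. Qed.

Lemma hilb_cat P Q z : hilb (P ++ Q) z = hilb P z + hilb Q z.
Proof. by rewrite /hilb big_cat. Qed.

Lemma hilb_perm P Q z : perm_eq P Q -> hilb P z = hilb Q z.
Proof. by move=> PQ; rewrite /hilb (perm_big Q). Qed.

Lemma cone_hilb_rec u z :
  cone_hilb u.+1 z.+1 = cone_hilb u.+1 z + cone_hilb u z.+1.
Proof.
case: u => [|u]; first by rewrite /cone_hilb !bin0.
by rewrite /cone_hilb addSn binS addSnnS.
Qed.

(** Numerical form of h K[x_1, ..., x_{u+1}] = h K[x_1, ..., x_u] + x_{u+1} h K[x_1, ..., x_{u+1}],
    a direct sum. *)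
Lemma shifted_hilb_split e u z :
  shifted_hilb (e, u.+1) z = shifted_hilb (e, u) z + shifted_hilb (e.+1, u.+1) z.
Proof.
rewrite /shifted_hilb [(_, _).1]/= [(_, _).2]/=.
have [ez|ez|->] := ltngtP e z.
- by rewrite -(subnSK ez) cone_hilb_rec addnC.
- by [].
- by rewrite subnn addn0; case: u => [|u]; rewrite /cone_hilb //= !add0n !binn //.
Qed.

(** Iterated splitting: each step raises the full cone by one degree and leaves behind a cone in [u]
    variables, which the outer induction lifts to [b]. The main cone stops in degree [b'], a
    separate parameter because it is sometimes raised by a single degree only. *)
Lemma cone_lift u e b' b : e <= b' <= b -> exists L,
  (forall c : nat * nat, c \in L -> c.2 <= u /\ (0 < c.2 -> c.1 = b)) /\
  forall z, shifted_hilb (e, u.+1) z = shifted_hilb (b', u.+1) z + hilb L z.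
Proof.
elim: u e b' => [|u IHu] e b' /andP[eb bb].
  move kE: (b' - e) => k; elim: k e eb kE => [|k IHk] e eb kE.
    have -> : b' = e by lia.
    by exists [::]; split=> // z; rewrite /hilb big_nil addn0.
  have [||L [L1 L2]] := IHk e.+1; try by lia.
  exists ((e, 0) :: L); split=> [c|z].
    by rewrite inE => /predU1P[->|/L1].
  by rewrite hilb_cons shifted_hilb_split L2; lia.
move kE: (b' - e) => k; elim: k e eb kE => [|k IHk] e eb kE.
  have -> : b' = e by lia.
  by exists [::]; split=> // z; rewrite /hilb big_nil addn0.
have [||L [L1 L2]] := IHk e.+1; try by lia.
have [|L' [L'1 L'2]] := IHu e b; first by lia.
exists ((b, u.+1) :: L' ++ L); split=> [c|z].
  rewrite inE mem_cat => /predU1P[->|/orP[/L'1|/L1]] //= [c2 c1].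
  by split=> //; apply: leqW.
by rewrite hilb_cons hilb_cat shifted_hilb_split L2 L'2; lia.
Qed.

(** The last two conclusions preserve the witnesses of standardness in degrees from [b] on, and
    prevent the largest degree from dropping; the latter carries degree bounds back to the original
    list. *)
Lemma cone_list_lift P b M : (forall c : nat * nat, c \in P -> c.2 <= M) -> exists P',
  [/\ forall z, hilb P z = hilb P' z,
      forall c : nat * nat, c \in P' -> c.2 <= M,
      forall c : nat * nat, c \in P' -> 0 < c.2 -> c.1 = b \/ (b <= c.1 /\ c \in P),
      forall c : nat * nat, c \in P -> (0 < c.2 -> b <= c.1) -> c \in P' &
      forall c : nat * nat, c \in P -> exists2 c' : nat * nat, c' \in P' & c.1 <= c'.1].
Proof.
elim: P => [|[e u] P IH] PM; first by exists [::]; split.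
have [|P' [h1 h2 h3 h4 h5]] := IH.
  by move=> c cP; apply: PM; rewrite inE cP orbT.
have uM : u <= M by apply: (PM (e, u)); rewrite mem_head.
have [keep|] := boolP ((u == 0) || (b <= e)).
  exists ((e, u) :: P'); split=> [z|c|c|c|c].
  - by rewrite !hilb_cons h1.
  - by rewrite inE => /predU1P[->|/h2].
  - rewrite inE => /predU1P[-> /= u0|cP' c2].
      by right; rewrite mem_head; split=> //; case/orP: keep => // /eqP; lia.
    have [->|[bc cP]] := h3 c cP' c2; first by left.
    by right; rewrite inE cP orbT.
  - by rewrite !inE => /predU1P[->|cP] ck; rewrite ?eqxx // h4 ?orbT.
  - rewrite inE => /predU1P[->|/h5[c' c'P' cc']].
      by exists (e, u); rewrite ?mem_head.
    by exists c' => //; rewrite inE c'P' orbT.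
rewrite negb_or -ltnNge => /andP[u0 eb].
case: u => // u in uM u0 PM *.
have [|L [L1 L2]] := @cone_lift u e b b; first by lia.
exists ((b, u.+1) :: L ++ P'); split=> [z|c|c|c|c].
- by rewrite !hilb_cons hilb_cat h1 L2 addnA.
- rewrite inE mem_cat => /predU1P[->|/orP[/L1[]|/h2]] //=; lia.
- rewrite inE mem_cat => /predU1P[->|/orP[/L1[_ c1]/c1 ->|cP' c2]]; try by left.
  have [->|[bc cP]] := h3 c cP' c2; first by left.
  by right; rewrite inE cP orbT.
- rewrite !inE mem_cat => /predU1P[->|cP] ck; last by rewrite h4 ?orbT.
  by have := ck isT => /=; lia.
- rewrite inE => /predU1P[->|/h5[c' c'P' cc']].
    by exists (b, u.+1); rewrite ?mem_head //=; lia.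
  by exists c' => //; rewrite inE mem_cat c'P' !orbT.
Qed.

Lemma standard_cat q P Q : standard q P -> standard q Q -> standard q (P ++ Q).
Proof.
move=> sP sQ c; rewrite mem_cat => /orP[/sP|/sQ] s /s[qc ex]; split=> // e /ex[c' c'P cc'];
  by exists c'; rewrite // mem_cat c'P ?orbT.
Qed.

(** The lifted cones all land in degree [b], where there is no gap to fill, and the witnesses in
    degrees from [b] on are untouched. *)
Lemma standard_lift q b P M : standard q P -> q <= b ->
  (forall c : nat * nat, c \in P -> c.2 <= M) -> exists P',
  [/\ forall z, hilb P z = hilb P' z, forall c : nat * nat, c \in P' -> c.2 <= M & standard b P'].
Proof.
move=> sP qb PM; have [P' [h1 h2 h3 h4 _]] := @cone_list_lift P b M PM.
exists P'; split=> // c cP' c2.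
have [c1|[bc cP]] := h3 c cP' c2.
  split=> [|e]; first by rewrite c1.
  by rewrite c1 => eb; exists c => //; split=> //; lia.
split=> // e be; have [_] := sP c cP c2.
case/(_ e); first by lia.
move=> c' c'P [c'1 cc']; exists c' => //; apply: h4 => //; lia.
Qed.

(* Only contiguity of the degrees is used: the cones of top dimension start at
   [q] without gaps, so one of them can be left in degree [q] and the others
   pushed to degree at least [q + 1]. *)
Lemma top_cones_spread u q b (T : seq nat) : q + size T = b ->
  (forall e : nat, e \in T -> q <= e /\ forall e', q <= e' <= e -> e' \in T) ->
  exists L, [/\ forall c : nat * nat, c \in L -> c.2 <= u /\ (0 < c.2 -> c.1 = b),
    forall e : nat, e \in T -> e < b &
    forall z, hilb [seq (e, u.+1) | e <- T] z =
      \sum_(q <= j < b) shifted_hilb (j, u.+1) z + hilb L z].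
Proof.
move kE: (size T) => k; elim: k q T kE => [|k IH] q T kE qb Tq.
  exists [::]; split=> // [e|z]; rewrite (size0nil kE) //.
  by rewrite /hilb big_nil big_geq //; lia.
have qT : q \in T.
  case: T kE Tq => // e T _ /(_ e); rewrite mem_head => /(_ isT)[qe].
  by apply; rewrite leqnn qe.
set T1 := rem q T.
have lift_rem (S : seq nat) : (forall e, e \in S -> q <= e) -> q < b -> exists L,
    (forall c : nat * nat, c \in L -> c.2 <= u /\ (0 < c.2 -> c.1 = b)) /\
    forall z, hilb [seq (e, u.+1) | e <- S] z =
      hilb [seq (e, u.+1) | e <- [seq maxn q.+1 e | e <- S]] z + hilb L z.
  elim: S => [|e S IHS] Sq q_lt; first by exists [::]; split=> // z; rewrite /hilb !big_nil.
  have [|L [L1 L2]] := IHS _ q_lt; first by move=> f fS; apply: Sq; rewrite inE fS orbT.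
  have qe : q <= e by apply: Sq; rewrite mem_head.
  have [eq|eq] := eqVneq e q; last first.
    exists L; split=> // z; rewrite !map_cons !hilb_cons L2.
    by rewrite (maxn_idPr _) ?addnA // ltn_neqAle eq_sym eq.
  have [|L' [L'1 L'2]] := @cone_lift u e q.+1 b; first by lia.
  exists (L' ++ L); split=> [c|z].
    by rewrite mem_cat => /orP[/L'1|/L1].
  rewrite !map_cons !hilb_cons L2 hilb_cat L'2; have -> : maxn q.+1 e = q.+1 by lia.
  lia.
have [e /mem_rem/Tq[]//||L1 [L11 L12]] := lift_rem T1; first by rewrite -qb; lia.
have mT1 e : e != q -> (e \in T1) = (e \in T).
  by move=> eq; apply/idP/idP => [/mem_rem//|]; apply: rem_mem.
have [|||L2 [L21 L22 L23]] := IH q.+1 [seq maxn q.+1 e | e <- T1].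
- by rewrite size_map size_rem // kE.
- by lia.
- move=> _ /mapP[e eT ->]; split=> [|e' e'b]; first by lia.
  apply/mapP; have [eq|eq] := leqP e q.
    by exists e; rewrite //; lia.
  exists e'; last by lia.
  have {}eT := mem_rem eT; rewrite mT1; last by lia.
  by have [_] := Tq e eT; apply; lia.
exists (L1 ++ L2); split=> [c|e eT|z].
- by rewrite mem_cat => /orP[/L11|/L21].
- have [->|eq] := eqVneq e q; first by lia.
  have : maxn q.+1 e \in [seq maxn q.+1 e | e <- T1] by apply: map_f; rewrite mT1.
  by move/L22; lia.
- rewrite (hilb_perm (Q := [seq (e, u.+1) | e <- q :: T1])); last first.
    exact/perm_map/perm_to_rem.
  rewrite map_cons hilb_cons L12 L23 hilb_cat [in RHS]big_ltn; last by rewrite -qb; lia.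
  by rewrite -!addnA [hilb L2 z + _]addnC.
Qed.

(** Induction on the dimension: the cones of top dimension are spread one per degree from [q] to
    [b - 1], the smaller ones are lifted to degree at least [b], and what remains is standard from
    [b]. The multiset [Z] collects the degrees of the zero-dimensional cones; with [b 1] it
    dominates all original degrees. *)
Lemma exact_decomposition N q P : standard q P ->
  (forall c : nat * nat, c \in P -> c.2 <= N) -> exists (b : nat -> nat) (Z : seq nat),
  [/\ b N.+1 = q, forall i, 0 < i <= N -> b i.+1 <= b i,
      forall z, hilb P z = \sum_(1 <= i < N.+1) \sum_(b i.+1 <= j < b i)
        shifted_hilb (j, i) z + count_mem z Z &
      forall c : nat * nat, c \in P -> c.1 < b 1 \/ exists2 e : nat, e \in Z & c.1 <= e].
Proof.
elim: N q P => [|N IH] q P sP PN.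
  exists (fun=> q), (map fst P); split=> // [z|c cP].
    rewrite big_geq // add0n; elim: P PN {sP} => [|[e u] P IHP] PN.
      by rewrite /hilb big_nil.
    rewrite hilb_cons /= -IHP => [|c cP]; last by apply: PN; rewrite inE cP orbT.
    have := PN (e, u); rewrite mem_head => /(_ isT) /= u0.
    have -> : u = 0 by lia.
    by congr (_ + _); rewrite /shifted_hilb /=; case: leqP; lia.
  by right; exists c.1 => //; apply: map_f.
pose T := [seq c.1 | c <- P & c.2 == N.+1].
pose b := q + size T; pose Q := [seq c <- P | c.2 <= N].
have Tmem e : (e \in T) = ((e, N.+1) \in P).
  apply/mapP/idP => [[[e' u]]|eP].
    by rewrite mem_filter /= => /andP[/eqP -> ?] ->.
  by exists (e, N.+1); rewrite // mem_filter eqxx.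
have [|L [L1 L2 L3]] := @top_cones_spread N q b T erefl.
  move=> e; rewrite Tmem => eP; have [//|qe ex] := sP _ eP; split=> // e' /ex.
  case=> -[e'' u] c'P /= [<- uN]; rewrite Tmem.
  by have -> : N.+1 = u by have := PN _ c'P; rewrite /=; lia.
have [c|Q' [h1 h2 h3 h4 h5]] := @cone_list_lift Q b N; first by rewrite mem_filter => /andP[].
have [||b' [Z [b1 b2 b3 b4]]] := IH b (L ++ Q').
- move=> c; rewrite mem_cat => /orP[|] cL c2.
    have [_ /(_ c2) c1] := L1 c cL; split=> [|e]; first by lia.
    by move=> eb; exists c; rewrite ?mem_cat ?cL //; split=> //; lia.
  have [c1|[bc cQ]] := h3 c cL c2.
    split=> [|e]; first by rewrite c1.
    by rewrite c1 => eb; exists c; rewrite ?mem_cat ?cL ?orbT //; split=> //; lia.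
  split=> // e be; move: cQ; rewrite mem_filter => /andP[cN cP].
  have [_] := sP c cP c2; case/(_ e) => [|c' c'P [c'1 cc']]; first by lia.
  exists c' => //; rewrite mem_cat h4 ?orbT //; last by lia.
  rewrite mem_filter c'P andbT -ltnS ltn_neqAle; have := PN _ c'P => ->; rewrite andbT.
  (* A witness of top dimension would lie in degree at least [b], whereas all top cones have degree
     below [b]; so the witness survives in [Q]. *)
  apply/eqP => c'N; have : c'.1 \in T by rewrite Tmem -c'N -surjective_pairing.
  by move/L2; lia.
- by move=> c; rewrite mem_cat => /orP[/L1[]|/h2].
exists (fun i => if i == N.+2 then q else b' i), Z; split=> [|i iN|z|c cP].
- by rewrite eqxx.
- rewrite eqSS; case: eqVneq => [->|iN']; last first.
    by case: eqP => [|_]; [lia|apply: b2; lia].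
  by rewrite ifN ?b1 ?leq_addr //; apply/eqP; lia.
- rewrite (@hilb_perm _ ([seq c <- P | c.2 == N.+1] ++ Q)); last first.
    rewrite perm_sym; have -> : Q = [seq c <- P | predC (fun c => c.2 == N.+1) c].
      by apply: eq_in_filter => c /PN /= cN; lia.
    by rewrite perm_filterC.
  rewrite hilb_cat h1; have -> : [seq c <- P | c.2 == N.+1] = [seq (e, N.+1) | e <- T].
    rewrite /T -map_comp -[LHS]map_id; apply/eq_in_map => -[e u].
    by rewrite mem_filter => /andP[/eqP /= ->].
  rewrite L3 big_nat_recr //= eqxx [N.+1 == N.+2]ltn_eqF // -addnA.
  have -> : hilb L z + hilb Q' z =
      \sum_(1 <= i < N.+1) \sum_(b' i.+1 <= j < b' i) shifted_hilb (j, i) z + count_mem z Z.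
    by rewrite -hilb_cat b3.
  rewrite b1 addnCA addnA; congr (_ + _ + _); apply: eq_big_nat => i iN.
  by rewrite eqSS !ifN //; apply/eqP; lia.
have b1_ge : b <= b' 1.
  suff b_le k : k <= N -> b' k.+1 <= b' 1 by rewrite -b1 b_le.
  elim: k => // k IHk kN; apply: leq_trans (IHk (ltnW kN)); exact: b2.
rewrite /=.
have [cN|cN] := leqP c.2 N; last first.
  left; apply: leq_trans b1_ge; apply: L2; rewrite Tmem.
  have -> : N.+1 = c.2 by have := PN _ cP; lia.
  by rewrite -surjective_pairing.
have [|c' c'Q cc'] := h5 c; first by rewrite mem_filter cN.
have [|c'b|[e eZ ce]] := b4 c'; first by rewrite mem_cat c'Q orbT.
  by left; lia.
by right; exists e; rewrite // (leq_trans cc').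
Qed.

End ConeLists.

(** * Macaulay constants *)

(* The polynomial function x |-> x (x + 1) ... (x + k - 1) / k!, whose backward
   difference is [risebin k.-1]. *)
Definition risebin (k : nat) (x : int) : int :=
  match x with
  | Posz m => 'C(m + k.-1, k)%:Z
  | Negz m => (-1) ^+ k * 'C(m.+1, k)%:Z
  end.

Lemma risebin0 x : risebin 0 x = 1.
Proof. by case: x => m; rewrite /risebin ?bin0 ?mulr1. Qed.

Lemma risebinN k (m : nat) : risebin k (- m%:Z) = (-1) ^+ k * 'C(m, k)%:Z.
Proof.
case: m => [|m]; last by rewrite -NegzE.
rewrite oppr0 /= add0n; case: k => [|k]; first by rewrite !bin0 mulr1.
by rewrite bin_small // bin0n mulr0.
Qed.

Lemma risebin_rec k x : risebin k.+1 (x + 1) = risebin k.+1 x + risebin k (x + 1).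
Proof.
case: x => [m|[|m]].
- rewrite [Posz m + 1]addrC -PoszD add1n /risebin /= addSn binS PoszD; congr (_ + _).
  by case: k => [|k]; rewrite ?bin0 //= addSnnS.
- rewrite /=; case: k => [|k] //=.
  by rewrite !bin_small // mulr0.
- have -> : Negz m.+1 + 1 = - m.+1%:Z by rewrite NegzE; lia.
  rewrite NegzE !risebinN (binS m.+1) PoszD !exprS; ring.
Qed.

Lemma cone_hilb_risebin i z : (cone_hilb i.+1 z)%:Z = risebin i (z%:Z + 1).
Proof.
rewrite -PoszD addn1 /risebin /cone_hilb.
by case: i => [|i]; rewrite ?bin0 //= addSnnS.
Qed.

(** Telescoping sum, since [risebin i] is the backward difference of [risebin i.+1]. The bound on
    [b'] ensures that every cone of the sum has started by degree [z]. *)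
Lemma sum_shifted_hilb i (b b' z : nat) : (b <= b')%N -> (b' <= z.+1)%N ->
  (\sum_(b <= j < b') shifted_hilb (j, i.+1) z)%:Z =
    risebin i.+1 (z%:Z - b%:Z + 1) - risebin i.+1 (z%:Z - b'%:Z + 1) :> int.
Proof.
move=> bb'; rewrite -(subnKC bb'); elim: (b' - b)%N => [|k IH] kz.
  by rewrite addn0 big_geq // subrr.
rewrite addnS big_nat_recr ?leq_addr //= PoszD IH; last by lia.
rewrite /shifted_hilb ifT; last by rewrite /=; lia.
rewrite cone_hilb_risebin [(_, _).1]/=.
have -> : (z - (b + k))%N%:Z = z%:Z - (b + k)%N%:Z by rewrite -subzn //; lia.
have -> : z%:Z - (b + k).+1%:Z + 1 = z%:Z - (b + k)%N%:Z by lia.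
rewrite [X in _ - X + _]risebin_rec; ring.
Qed.

(** After the inner telescoping, [risebin_rec] turns [risebin i (z - b i + 1)] into
    [risebin i (z - b i)] plus a term of index [i - 1] that cancels against the previous dimension.
    The outer sum telescopes too, and the -1 is its lower end [risebin 0]. *)
Lemma exact_hilb_risebin N (b : nat -> nat) (z : nat) :
  (forall i, (0 < i <= N)%N -> (b i.+1 <= b i)%N) ->
  (b 1 <= z.+1)%N ->
  (\sum_(1 <= i < N.+1) \sum_(b i.+1 <= j < b i) shifted_hilb (j, i) z)%N%:Z =
  risebin N (z%:Z - (b N.+1)%:Z + 1) - 1 -
    \sum_(1 <= i < N.+1) risebin i (z%:Z - (b i)%:Z).
Proof.
move=> bdec b1z; elim: N bdec => [|N IH] bdec.
  by rewrite !big_geq // risebin0.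
have {}IH := IH (fun i iN => bdec i ltac:(lia)).
rewrite !(big_nat_recr N.+1) //= PoszD IH.
have b_le i : (0 < i <= N.+1)%N -> (b i <= b 1)%N.
  case: i => // i; elim: i => // i IHi iN.
  have bi : (b i.+2 <= b i.+1)%N by apply: bdec; lia.
  by apply: leq_trans bi _; apply: IHi; lia.
rewrite sum_shifted_hilb; last 2 first.
- by apply: bdec; rewrite ltnSn.
- by apply: leq_trans b1z; apply: b_le; rewrite ltnSn.
rewrite [X in _ + (_ - X)]risebin_rec; ring.
Qed.

Section MacaulayConstants.
Variables (N d : nat) (a b : nat -> nat).

(* For large [z], the two exact cone lists with Macaulay constants [a] and [b]
   complement each other if and only if [macaulay_diff 1 z] is the number of their
   zero-dimensional cones in degree [z]; [macaulay_diff j.+1] is the backward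
   difference of [macaulay_diff j]. *)
Definition macaulay_diff (j : nat) (z : int) : int :=
  \sum_(j <= i < N.+1)
    (risebin (i - j).+1 (z - (a i)%:Z) + risebin (i - j).+1 (z - (b i)%:Z)) +
  2 - 2 * risebin (N.+1 - j) (z - d%:Z + 1).

Local Notation F := macaulay_diff.

Let F_top z : F N.+1 z = 0.
Proof. by rewrite /macaulay_diff big_geq // subnn risebin0. Qed.

Let F_rec j z : (j <= N)%N -> F j (z + 1) = F j z + F j.+1 (z + 1).
Proof.
move=> jN; suff <- : F j (z + 1) - F j z = F j.+1 (z + 1) by rewrite [RHS]addrC subrK.
have -> : F j (z + 1) - F j z = \sum_(j <= i < N.+1)
    (risebin (i - j) (z + 1 - (a i)%:Z) + risebin (i - j) (z + 1 - (b i)%:Z)) -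
    2 * risebin (N - j) (z + 1 - d%:Z + 1).
  have step k c : risebin k.+1 (z + 1 - c) = risebin k.+1 (z - c) + risebin k (z + 1 - c).
    by rewrite addrAC risebin_rec.
  have stepd k : risebin k.+1 (z + 1 - d%:Z + 1) =
      risebin k.+1 (z - d%:Z + 1) + risebin k (z + 1 - d%:Z + 1).
    by rewrite (addrAC z 1) risebin_rec.
  rewrite /macaulay_diff subSn // stepd.
  under eq_bigr => i _ do rewrite !step addrACA.
  rewrite big_split /=; ring.
rewrite big_ltn // subnn !risebin0 /macaulay_diff subSS.
rewrite (eq_big_nat _ _ (F2 := fun i => risebin (i - j.+1).+1 (z + 1 - (a i)%:Z) +
  risebin (i - j.+1).+1 (z + 1 - (b i)%:Z))); first ring.
by move=> i iN; have -> : (i - j = (i - j.+1).+1)%N by lia.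
Qed.

Let const_of_step (g : int -> int) : (forall z, g (z + 1) = g z) -> forall z, g z = g 0.
Proof.
move=> gS; elim/int_ind => // n IH; first by rewrite -IH -(gS n%:Z) -PoszD addn1.
by rewrite -IH (_ : - n%:Z = - n.+1%:Z + 1) ?gS //; lia.
Qed.

(** A polynomial vanishing for all large arguments is zero, argued through differences: all [F j]
    vanish eventually, and if [F j.+1] is identically zero then [F j] is constant, hence zero,
    starting from [F N.+1 = 0]. *)
Lemma macaulay_diff_eq0 : (exists z0 : nat, forall z : nat, (z0 <= z)%N -> F 1 z%:Z = 0) ->
  forall j z, (0 < j <= N.+1)%N -> F j z = 0.
Proof.
case=> z0 F1; have Fj j : (0 < j <= N.+1)%N -> forall z : nat, (z0 + j <= z)%N -> F j z%:Z = 0.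
  elim: j => // -[|j] IHj jN z zj; first by apply: F1; lia.
  have {}IHj := IHj ltac:(lia); have [z' zE] : exists z' : nat, z = z'.+1.
    by exists z.-1; lia.
  have := @F_rec j.+1 z'%:Z ltac:(lia); rewrite -PoszD addn1 -zE.
  by rewrite !IHj ?add0r //; lia.
move=> j z /andP[j0 jN]; rewrite -(subKn jN); move: (leq_subr j N.+1).
have : (N.+1 - j < N.+1)%N by lia.
elim: (N.+1 - j)%N z => [|k IHk] z kN _; first by rewrite subn0 F_top.
have stepk y : F (N.+1 - k.+1) (y + 1) = F (N.+1 - k.+1) y.
  by rewrite F_rec -?subSn ?subSS ?IHk ?addr0 //; lia.
by rewrite (const_of_step stepk) -(const_of_step stepk (z0 + N.+1)%N%:Z) Fj //; lia.
Qed.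

(** This is [F j 0 = 0] solved for its linear part: at negative arguments [risebin] is a signed
    binomial, and the term of index [j] becomes [- (a j + b j)]. *)
Lemma macaulay_recursion : (0 < d)%N ->
  (exists z0 : nat, forall z : nat, (z0 <= z)%N -> F 1 z%:Z = 0) ->
  forall j, (0 < j <= N)%N ->
  (a j + b j)%:Z = 2 + \sum_(j.+1 <= i < N.+1)
     (-1) ^+ (i - j).+1 * ('C(a i, (i - j).+1) + 'C(b i, (i - j).+1))%N%:Z
     - 2 * (-1) ^+ (N.+1 - j) * 'C(d.-1, N.+1 - j)%:Z.
Proof.
move=> d0 F1 j jN; have := @macaulay_diff_eq0 F1 j 0 ltac:(lia).
rewrite /macaulay_diff big_ltn ?ltnS ?(andP jN).2 // subnn.
have -> : 0 - d%:Z + 1 = - d.-1%:Z by lia.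
under eq_big_nat => i iN do rewrite !sub0r !risebinN -mulrDr -PoszD.
rewrite !sub0r !risebinN expr1 !bin1 => e.
apply/eqP; rewrite -subr_eq0 -oppr_eq0 -[X in _ == X]e PoszD;
  apply/eqP; ring.
Qed.

(** Indexed from the top dimension, so that the descending induction on the constants becomes an
    ascending one. *)
Let X m := (a (N - m) + b (N - m))%N.

(* The terms of odd index in [macaulay_recursion] are nonpositive and dropped. *)
Lemma macaulay_recursion_le : (0 < d)%N ->
  (exists z0 : nat, forall z : nat, (z0 <= z)%N -> F 1 z%:Z = 0) ->
  ((0 < N)%N -> X 0 = d.*2) /\
  forall m, (0 < m < N)%N ->
    (X m <= 2 + \sum_(2 <= k < m.+2 | ~~ odd k) 'C(X (m.+1 - k), k)
              + (if odd m then 0 else 'C(d.-1, m.+1).*2))%N.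
Proof.
move=> d0 F1; split=> [N0|m mN].
  have jN : (0 < N <= N)%N by lia.
  have := macaulay_recursion d0 F1 jN.
  rewrite big_geq // subSnn bin1 expr1 /X subn0 mulrN1 mulNr opprK addr0 => e.
  by apply/eqP; rewrite -eqz_nat e -(prednK d0) -mul2n mulnS.
have jN : (0 < N - m <= N)%N by lia.
have := macaulay_recursion d0 F1 jN.
have -> : (N.+1 - (N - m) = m.+1)%N by lia.
have -> : (N - m).+1 = (2 + (N - m).-1)%N by lia.
have -> : N.+1 = (m.+2 + (N - m).-1)%N by lia.
rewrite big_addn addnK => e; rewrite -lez_nat e !PoszD.
rewrite -[leLHS]addrA -[leRHS]addrA lerD2l; apply: lerD; last first.
  by rewrite -signr_odd /=; case: (odd m) => /=; rewrite ?expr0 ?expr1 ?mulr1 ?mulrN1; lia.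
rewrite -[X in _ <= X]/(Posz _) (big_morph Posz PoszD (erefl _)) [leRHS]big_mkcond.
apply: ler_sum_nat => k kN; have -> : ((k + (N - m).-1 - (N - m)).+1 = k)%N by lia.
rewrite -signr_odd; case: odd => /=; first by rewrite expr1; lia.
have -> : (k + (N - m).-1 = N - (m.+1 - k))%N by lia.
rewrite expr0 mul1r lez_nat /X; move: (a _) (b _) => x y.
have [k' ->] : exists k', k = k'.+1 by exists k.-1; lia.
(* Superadditivity of the binomial coefficient in its upper argument, where a positive lower index
   matters. *)
elim: y => [|y IH]; first by rewrite bin0n !addn0.
by rewrite addnS !binS; apply: leq_trans (leq_add IH (leq_bin2l _ (leq_addl x y))); lia.
Qed.

End MacaulayConstants.

(** * Numerical solution of the recursion *)

Lemma bin_le_expn (m k : nat) : ('C(m, k) * k`! <= m ^ k)%N.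
Proof.
rewrite bin_ffact; elim: k => // k IH.
by rewrite ffactnSr expnSr leq_mul // leq_subr.
Qed.

(** The maximum of 4^k / k! is 32 / 3, reached at k = 3 and k = 4. It turns (4 / 3)^k / k! into a
    geometric term of ratio 1 / 3. *)
Lemma exp4_le_fact (k : nat) : (3 * 4 ^ k <= 32 * k`!)%N.
Proof.
case: k => [|[|[|k]]] //; elim: k => // k IH.
by rewrite expnS factS mulnCA [leqRHS]mulnCA leq_mul.
Qed.

(** The value 1 / 54 is that of the infinite series, 3^-4 times 3 / 2. *)
Lemma geometric_tail_le (F : realFieldType) (n : nat) :
  \sum_(4 <= k < n) (3^-1 : F) ^+ k <= 54^-1.
Proof.
have [n4|n4] := leqP n 4; first by rewrite big_geq // invr_ge0 ler0n.
suff E : \sum_(4 <= k < n) (3^-1 : F) ^+ k = 54^-1 - 3 / 2 * 3^-1 ^+ n.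
  have : 0 <= (3^-1 : F) ^+ n by rewrite exprn_ge0 // invr_ge0 ler0n.
  rewrite E; lra.
rewrite -(subnKC n4); elim: (n - 5)%N => [|k IH].
  by rewrite addn0 big_nat1; field.
by rewrite addnS big_nat_recr //= IH exprS; field.
Qed.

(* The factor 4 / 3 < 2 leaves room, next to the term k = 2, for the constant 2,
   the terms k >= 4 and the last summand. *)
Lemma recursion_bound (F : realFieldType) (N d : nat) (X : nat -> nat) :
  (0 < d)%N -> ((0 < N)%N -> X 0%N = d.*2) ->
  (forall m, (0 < m < N)%N ->
    (X m <= 2 + \sum_(2 <= k < m.+2 | ~~ odd k) 'C(X (m.+1 - k), k)
              + (if odd m then 0 else 'C(d.-1, m.+1).*2))%N) ->
  forall m, (m < N)%N ->
    (X m)%:R <= 4 / 3 * (d%:R ^+ 2 / 2 + d%:R) ^+ (2 ^ m) :> F.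
Proof.
move=> d0 X0 rec; set c := _ / 2 + _ : F.
have d1 : 1 <= d%:R :> F by rewrite ler1n.
have c32 : 3 / 2 * d%:R <= c by rewrite /c; nra.
have c1 : 1 <= c by lra.
pose x m := c ^+ (2 ^ m).
have x_ge1 m : 1 <= x m by rewrite exprn_ege1.
have xS m : x m.+1 = x m ^+ 2 by rewrite /x -exprM expnSr.
(* At [d = 1] the base case is the equality 2 = 4 / 3 * 3 / 2, which fixes the factor 4 / 3. *)
elim/ltn_ind => -[|m] IH mN; first by rewrite X0 // expr1 -addnn natrD; nra.
have {}IH k : (k <= m)%N -> (X k)%:R <= 4 / 3 * x k by move=> km; apply: IH; lia.
(* The negative linear term of y (y - 1) / 2 at y = 4 / 3 * [x m] is kept, to absorb the tail and
   part of the constant 2. *)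
have quad : 'C(X m, 2)%:R <= 8 / 9 * x m.+1 - 2 / 3 * x m.
  have IHm := IH m (leqnn m); have := x_ge1 m; rewrite xS => xm1.
  have : 2 * 'C(X m, 2)%:R = (X m)%:R * ((X m)%:R - 1) :> F.
    have [->|X_gt0] := posnP (X m); first by rewrite mul0r mulr0.
    rewrite -[X in _ - X]/(1%:R) -natrB // -!natrM; congr _%:R.
    by rewrite mulnC -[2%N in LHS]/(2`!) bin_ffact ffactnS ffactn1 subn1.
  have : 0 <= (X m)%:R :> F by rewrite ler0n.
  move: ('C(_, _)%:R) (X m)%:R IHm => y z IHm z0 yE.
  have : 0 <= (4 / 3 * x m - z) * (4 / 3 * x m + z - 1) by apply: mulr_ge0; lra.
  nra.
(* The constant comes from 32 / 3 * 1 / 54 = 16 / 81 < 1 / 5. *)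
have tail : (\sum_(4 <= k < m.+3 | ~~ odd k) 'C(X (m.+2 - k), k))%N%:R <= 1 / 5 * x m.
  have term k : (4 <= k < m.+3)%N ->
      'C(X (m.+2 - k)%N, k)%:R <= 32 / 3 * x m * (3^-1) ^+ k :> F.
    move=> kN; have kf : 0 < k`!%:R :> F by rewrite ltr0n fact_gt0.
    rewrite -(ler_pM2r kf) -natrM; apply: (@le_trans _ _ ((X (m.+2 - k)%N)%:R ^+ k)).
      by rewrite -natrX ler_nat bin_le_expn.
    apply: (@le_trans _ _ ((4 / 3 * x (m.+2 - k)%N) ^+ k)).
      have := x_ge1 (m.+2 - k)%N => xk1.
      by apply: lerXn2r; rewrite ?nnegrE ?ler0n ?IH //; [lra|lia].
    rewrite exprMn expr_div_n -exprM.
    (* From [k = 4] on, k <= 2^(k-2); hence these terms have only the order of [x m], not that of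
       its square [x m.+1]. *)
    have xk : c ^+ (2 ^ (m.+2 - k) * k) <= x m.
      have pow2_ge j : (j.+4 <= 2 ^ j.+2)%N.
        by elim: j => // j IHj; rewrite expnS; lia.
      have -> : x m = c ^+ (2 ^ (m.+2 - k) * 2 ^ (k - 4).+2).
        by rewrite -expnD; congr (_ ^+ (2 ^ _)); lia.
      apply: ler_weXn2l; rewrite // leq_mul2l; apply/orP; right.
      by apply: leq_trans (pow2_ge _); lia.
    have fk : 4 ^+ k <= 32 / 3 * k`!%:R :> F.
      have := exp4_le_fact k; rewrite -(ler_nat F) !natrM natrX => ?; lra.
    have x0 : 0 <= x m by have := x_ge1 m; lra.
    have := ler_pM (exprn_ge0 k (ler0n F 4)) (exprn_ge0 _ (le_trans ler01 c1)) fk xk.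
    have : 0 <= (3^-1) ^+ k :> F by rewrite exprn_ge0 // invr_ge0 ler0n.
    rewrite -[3 ^- k]exprVn => k3 /(ler_wpM2r k3); lra.
  rewrite big_mkcond /= natr_sum.
  apply: (@le_trans _ _ (\sum_(4 <= k < m.+3) 32 / 3 * x m * (3^-1) ^+ k)).
    apply: ler_sum_nat => k kN; case: ifP => _; first exact: term.
    by rewrite mulr_ge0 ?exprn_ge0 ?invr_ge0 ?ler0n //; have := x_ge1 m; lra.
  rewrite -mulr_sumr; have := geometric_tail_le F m.+3; have := x_ge1 m; nra.
(* The factor is 2 * 1 / 6 * 2 / 3: the doubling, the factorial of [m.+2 >= 3], and one factor
   [d <= 2 / 3 * c]. *)
have last_term : (0 < m)%N -> (if odd m.+1 then 0 else 'C(d.-1, m.+2).*2)%:R <= 2 / 9 * x m.+1.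
  move=> m0; have := x_ge1 m.+1 => xm1; case: ifP => _; first by rewrite mulr0n; lra.
  have : ('C(d.-1, m.+2) * 6 <= d ^ m.+2)%N.
    apply: leq_trans (leq_trans (bin_le_expn d.-1 m.+2) _).
      by rewrite leq_mul2l -[6%N]/(3`!); apply/orP; right; apply: leq_fact; lia.
    by rewrite leq_exp2r ?leq_pred.
  rewrite -(ler_nat F) natrM natrX -addnn natrD => bnd.
  have : d%:R ^+ m.+2 <= 2 / 3 * x m.+1.
    apply: (@le_trans _ _ (2 / 3 * c ^+ m.+2)).
      rewrite exprS [c ^+ _]exprS mulrA.
      apply: ler_pM; rewrite ?ler0n ?exprn_ge0 ?ler0n //; first by lra.
      by apply: lerXn2r; rewrite ?nnegrE ?ler0n //; lra.
    rewrite ler_pM2l; last by lra.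
    apply: ler_weXn2l => //; case: (m) m0 => // k _; elim: k => // k IHk.
    by rewrite expnS; lia.
  lra.
have c0 : 3 / 2 <= c by lra.
have := rec m.+1 ltac:(lia); rewrite -(ler_nat F); move/le_trans; apply.
rewrite big_ltn_cond //= subSS subn1 /= -/(x m.+1).
case: (posnP m) => [m0|m_gt0].
  (* There remains 2 <= 4 / 9 * c^2 + 2 / 3 * c, an equality at c = 3 / 2. *)
  rewrite m0 /= in quad xS *; rewrite big_geq // !addn0 natrD.
  have x0E : x 0%N = c by rewrite /x expr1.
  have := xS 0%N; rewrite x0E in quad *; nra.
rewrite big_ltn_cond; last by lia.
have := last_term m_gt0; rewrite /= !natrD.
(* There remains 2 <= 2 / 9 * y^2 + 7 / 15 * y for y = [x m], which holds from y = 9 / 4 on;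
   [1 <= x m] would not do. *)
have x1 : 3 / 2 * c <= x m.
  apply: (@le_trans _ _ (c ^+ 2)); first by nra.
  by apply: ler_weXn2l => //; rewrite -[2%N in leqLHS](expn1 2) leq_exp2l.
have := xS m; nra.
Qed.

(** Both exact lists are replaced by their polynomials. The polynomial of the whole ring cancels
    against the leading term of the [b] list, as [b N.+1 = 0]; the term at [a N.+1] occurs twice,
    from the full cone and from the [a] list, hence the factor 2 in [macaulay_diff]. *)
Lemma exact_identity_diff N (a b : nat -> nat) (Za Zb : seq nat) (z : nat) :
  (forall i, (0 < i <= N)%N -> (a i.+1 <= a i)%N) ->
  (forall i, (0 < i <= N)%N -> (b i.+1 <= b i)%N) -> b N.+1 = 0%N ->
  (a 1 <= z)%N -> (b 1 <= z)%N ->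
  cone_hilb N.+1 z = (shifted_hilb (a N.+1, N.+1) z +
    (\sum_(1 <= i < N.+1) \sum_(a i.+1 <= j < a i) shifted_hilb (j, i) z +
       count_mem z Za) +
    (\sum_(1 <= i < N.+1) \sum_(b i.+1 <= j < b i) shifted_hilb (j, i) z +
       count_mem z Zb))%N ->
  macaulay_diff N (a N.+1) a b 1 z%:Z = (count_mem z Za + count_mem z Zb)%N%:Z.
Proof.
move=> adec bdec b0 az bz.
have aN : (a N.+1 <= z)%N.
  suff ak k : (k <= N)%N -> (a k.+1 <= a 1)%N by apply: leq_trans az; exact: ak.
  elim: k => // k IH kN; have := adec k.+1 ltac:(lia); have := IH ltac:(lia); lia.
move/(congr1 Posz); rewrite !PoszD !exact_hilb_risebin //; try by lia.
rewrite /shifted_hilb /= aN -[X in Posz X]/(cone_hilb N.+1 z).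
rewrite -['C(z - _ + _, _)]/(cone_hilb N.+1 (z - a N.+1)) !cone_hilb_risebin -subzn //.
rewrite b0 subr0 /macaulay_diff subn1 /= => e.
rewrite (eq_big_nat _ _ (F2 := fun i => risebin i (z%:Z - (a i)%:Z) + risebin i (z%:Z - (b i)%:Z))).
  rewrite big_split /=; move: e; move: (risebin N _) ('C(_, _)) (count_mem z Za) (count_mem z Zb).
  by move: (\sum_(1 <= i < N.+1) _) (\sum_(1 <= i < N.+1) _) => A B g h x y; lia.
by move=> i iN; have -> : (i - 1).+1 = i by lia.
Qed.

Lemma dube_bound (R : realType) N d (P Q : seq (nat * nat)) : (0 < d)%N ->
  standard d P -> (forall c : nat * nat, c \in P -> (c.2 <= N)%N) ->
  standard 0 Q -> (forall c : nat * nat, c \in Q -> (c.2 <= N)%N) ->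
  (forall z, cone_hilb N.+1 z = shifted_hilb (d, N.+1) z + hilb P z + hilb Q z)%N ->
  exists D : nat, (forall c : nat * nat, c \in Q -> (c.1 < D)%N) /\
    D%:R <= 2 * (d%:R ^+ 2 / 2 + d%:R) `^ (2 `^ (N.+1%:R - 2)) :> R.
Proof.
move=> d0 sP PN sQ QN PQ.
have [a [Za [aN adec aE _]]] := exact_decomposition sP PN.
have [b [Zb [bN bdec bE bQ]]] := exact_decomposition sQ QN.
have diffE z : (maxn (a 1) (b 1) <= z)%N ->
    macaulay_diff N d a b 1 z%:Z = (count_mem z Za + count_mem z Zb)%N%:Z.
  rewrite geq_max => /andP[az bz]; rewrite -{1}aN; apply: exact_identity_diff => //.
  by rewrite aN PQ aE bE.
have ev0 : exists z0 : nat, forall z : nat, (z0 <= z)%N -> macaulay_diff N d a b 1 z%:Z = 0.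
  exists (maxn (a 1) (b 1) + \max_(e <- Za ++ Zb) e.+1)%N => z zD.
  rewrite diffE; last by lia.
  rewrite -count_cat; have -> // : count_mem z (Za ++ Zb) = 0%N.
  apply/count_memPn/negP => zZ; have zM := @leq_bigmax_seq _ (Za ++ Zb) predT succn z zZ isT.
  by have := leq_trans zM (leq_trans (leq_addl _ _) zD); rewrite ltnn.
have [X0 Xrec] := macaulay_recursion_le d0 ev0.
have diff0 z : macaulay_diff N d a b 1 z = 0.
  by apply: macaulay_diff_eq0.
exists (maxn (a 1) (b 1)); split=> [c cQ|].
  have [cb|[e eZ ce]] := bQ c cQ; first by rewrite leq_max cb orbT.
  rewrite ltnNge; apply/negP => De; have := diffE e (leq_trans De ce).
  rewrite diff0 => /eqP; rewrite eq_sym eqz_nat addn_eq0 => /andP[_].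
  by rewrite -leqn0 leqNgt -has_count has_pred1 eZ.
have d1 : 1 <= d%:R :> R by rewrite ler1n.
set c := _ / 2 + _; have c1 : 1 <= c by rewrite /c; nra.
(* In one variable the exponent is 1 / 2 and the degree is [d]; the claim is d <= 2 sqrt c, true
   because 4 c = 2 d^2 + 4 d. *)
have [N0|N0] := posnP N.
  rewrite N0 in aN bN *; rewrite aN bN maxn0.
  have -> : 1 - 2 = - 1 :> R by lra.
  rewrite powR_inv1 // powR12_sqrt; last by lra.
  have c0 : 0 <= c by lra.
  have := sqr_sqrtr c0; have := sqrtr_ge0 c; move: (Num.sqrt c) => s s0 sE.
  rewrite -ler_sqr ?nnegrE ?ler0n ?mulr_ge0 //.
  by rewrite exprMn sE /c; nra.
have -> : N.+1%:R - 2 = N.-1%:R :> R by rewrite -{1}(prednK N0) -addn2 natrD addrK.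
rewrite powR_mulrn ?ler0n // -natrX powR_mulrn; last by lra.
have X1 : (maxn (a 1) (b 1) <= a (N - N.-1) + b (N - N.-1))%N.
  have -> : (N - N.-1 = 1)%N by lia.
  by rewrite geq_max leq_addr leq_addl.
have Xb := @recursion_bound R N d (fun m => a (N - m) + b (N - m))%N d0 X0 Xrec N.-1 ltac:(lia).
rewrite -(ler_nat R) in X1; apply: le_trans X1 (le_trans Xb _).
have : 0 <= c ^+ (2 ^ N.-1) by rewrite exprn_ge0 //; lra.
by rewrite -/c; lra.
Qed.

(** * Monomial ideals *)

Section Monomials.
Import fintype finset.
Local Open Scope nat_scope.
Variable n : nat.
Implicit Types (u v g : 'X_{1..n}) (V s : {set 'I_n}) (G : seq 'X_{1..n}) (x : 'I_n).

(** Induction on the number of compared coordinates. If [B] bounds the next coordinate on a finite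
    set good for the first [k], that set still serves the exponents with next coordinate at least
    [B]; the finitely many slices below [B] are handled separately. *)
Lemma dickson (M : 'X_{1..n} -> Prop) : exists G : seq 'X_{1..n},
  (forall g, g \in G -> M g) /\ forall u, M u -> exists2 g, g \in G & (g <= u)%MM.
Proof.
suff D k : forall M : 'X_{1..n} -> Prop, exists G : seq 'X_{1..n},
    (forall g, g \in G -> M g) /\
    forall u, M u -> exists2 g, g \in G & forall i : 'I_n, i < k -> g i <= u i.
  have [G [GM Gu]] := D n M; exists G; split=> // u /Gu[g gG gu].
  by exists g => //; apply/mnm_lepP => i; apply: gu.
elim: k => [|k IHk] {}M.
  have [[u Mu]|M0] := EM (exists u, M u); last first.
    by exists [::]; split=> // u Mu; case: M0; exists u.
  by exists [:: u]; split=> [g|v Mv]; [rewrite inE => /eqP -> | exists u; rewrite ?mem_head].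
have [n_le|k_lt] := leqP n k.
  have [G [GM Gu]] := IHk M; exists G; split=> // u /Gu[g gG gu]; exists g => // i _.
  by apply: gu; apply: leq_trans n_le.
have [G0 [G0M G0u]] := IHk M; pose xk := Ordinal k_lt.
suff [B BG0] : exists B, forall g, g \in G0 -> g xk <= B.
  have [G1 [G1M G1u]] : exists G1 : seq 'X_{1..n}, (forall g, g \in G1 -> M g) /\
      forall u, M u -> u xk < B -> exists2 g, g \in G1 & forall i : 'I_n, i < k.+1 -> g i <= u i.
    elim: B {BG0} => [|B [G1 [G1M G1u]]]; first by exists [::].
    have [G2 [G2M G2u]] := IHk (fun u => M u /\ u xk = B).
    exists (G1 ++ G2); split=> [g|u Mu].
      by rewrite mem_cat => /orP[/G1M|/G2M[]].
    rewrite ltnS leq_eqVlt => /orP[/eqP uB|uB]; last first.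
      by have [g gG gu] := G1u u Mu uB; exists g; rewrite // mem_cat gG.
    have [g gG gu] := G2u u (conj Mu uB); exists g; rewrite ?mem_cat ?gG ?orbT // => i.
    rewrite ltnS leq_eqVlt => /orP[/eqP ik|]; last exact: gu.
    have -> : i = xk by apply: val_inj.
    by rewrite (G2M g gG).2 uB.
  exists (G0 ++ G1); split=> [g|u Mu].
    by rewrite mem_cat => /orP[/G0M|/G1M].
  have [Bu|uB] := leqP B (u xk); last first.
    by have [g gG gu] := G1u u Mu uB; exists g; rewrite // mem_cat gG orbT.
  have [g gG gu] := G0u u Mu; exists g; rewrite ?mem_cat ?gG // => i.
  rewrite ltnS leq_eqVlt => /orP[/eqP ik|]; last exact: gu.
  have -> : i = xk by apply: val_inj.
  exact: leq_trans (BG0 g gG) Bu.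
elim: G0 {G0M G0u} => [|g G0 [B BG0]]; first by exists 0.
exists (maxn (g xk) B) => h; rewrite inE leq_max => /predU1P[->|/BG0 ->]; rewrite ?leqnn ?orbT //.
Qed.

Lemma mnm_neq0 u : u != 0%MM -> exists i, u i != 0.
Proof.
move=> u0; apply/existsP; apply: contraNT u0; rewrite negb_exists => /forallP u0.
by apply/eqP/mnmP => i; rewrite mnm0E; apply/eqP; have := u0 i; rewrite negbK.
Qed.

Definition monomials (m : nat) : seq 'X_{1..n} :=
  map (@bmnm n m.+1) (enum [pred u : 'X_{1..n < m.+1} | mdeg u == m]).

Lemma mem_monomials m u : (u \in monomials m) = (mdeg u == m).
Proof.
apply/mapP/idP => [[v]|um]; first by rewrite mem_enum => vm ->.
have um1 : mdeg u < m.+1 by rewrite (eqP um).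
by exists (BMultinom um1); rewrite // mem_enum.
Qed.

Lemma uniq_monomials m : uniq (monomials m).
Proof. by rewrite map_inj_uniq ?enum_uniq //; exact: val_inj. Qed.

Definition on_vars V u := [forall i, (u i != 0) ==> (i \in V)].

Lemma on_varsP V u : reflect (forall i, i \notin V -> u i = 0) (on_vars V u).
Proof.
apply: (iffP forallP) => h i; last by apply/implyP; apply: contraNT => /h ->.
by move=> iV; apply/eqP; apply: contraNT iV => ui; have := h i; rewrite ui.
Qed.

(** Standard monomials in the sense of Groebner bases, those outside the ideal of [G]; unrelated to
    [standard] lists of cones. *)
Definition standard_mnm G u := ~~ has (fun g => (g <= u)%MM) G.

Definition standard_count V G m :=
  count (fun u => on_vars V u && standard_mnm G u) (monomials m).

(** Generators of the colon ideal by the variable [x]: the subtraction is truncated, so a generator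
    free of [x] is unchanged. *)
Definition colon_mnm G x := [seq (g - U_(x))%MM | g <- G].

Lemma standard_colon G x u :
  standard_mnm (colon_mnm G x) u = standard_mnm G (U_(x) + u)%MM.
Proof.
rewrite /standard_mnm has_map; congr (~~ _); apply: eq_has => g /=.
apply/mnm_lepP/mnm_lepP => h i; have := h i; rewrite !mnmDE !mnmBE; lia.
Qed.

Lemma count_monomials0 (P : pred 'X_{1..n}) : count P (monomials 0) = P 0%MM.
Proof.
rewrite (permP (_ : perm_eq _ [:: 0%MM])) /= ?addn0 //.
apply: uniq_perm; rewrite ?uniq_monomials // => u.
by rewrite mem_monomials inE mdeg_eq0.
Qed.

Lemma count_monomialsS (P : pred 'X_{1..n}) x m : count P (monomials m.+1) =
  count (fun u => (u x == 0) && P u) (monomials m.+1) +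
  count (fun u => P (U_(x) + u)%MM) (monomials m).
Proof.
have -> : count (fun u => P (U_(x) + u)%MM) (monomials m) =
    count P (filter (fun u => u x != 0) (monomials m.+1)).
  rewrite -(count_map (fun u => U_(x) + u)%MM P); apply/permP/uniq_perm.
  - by rewrite map_inj_uniq ?uniq_monomials //; exact: addmI.
  - by rewrite filter_uniq ?uniq_monomials.
  move=> u; rewrite mem_filter mem_monomials; apply/mapP/andP => [[v]|[ux um]].
    by rewrite mem_monomials => /eqP <- ->; rewrite mnmDE mnm1E eqxx mdegD mdeg1.
  have le_u : (U_(x) <= u)%MM by rewrite lep1mP.
  exists (u - U_(x))%MM; last by rewrite addmC submK.
  by rewrite mem_monomials; move: um; rewrite -{1}(submK le_u) mdegD mdeg1 addn1.
rewrite -(permP (permEl (perm_filterC (fun u => u x == 0) _))) count_cat.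
by rewrite !count_filter; congr (_ + _); apply: eq_count => u /=; rewrite andbC.
Qed.

Lemma on_vars_add V x u : x \in V -> on_vars V (U_(x) + u)%MM = on_vars V u.
Proof.
move=> xV; apply/on_varsP/on_varsP => h i iV; have := h i iV; rewrite mnmDE mnm1E.
  by move/eqP; rewrite addn_eq0 => /andP[_ /eqP].
by case: eqP iV => [<-|_ _ ->] //; rewrite xV.
Qed.

Lemma on_vars_del V x u : x \in V -> (u x == 0) && on_vars V u = on_vars (V :\ x) u.
Proof.
move=> xV; apply/andP/on_varsP => [[/eqP ux /on_varsP h] i|h].
  by rewrite !inE negb_and negbK => /orP[/eqP ->|/h].
by split; [rewrite h // !inE eqxx|apply/on_varsP => i iV; rewrite h // !inE negb_and iV orbT].
Qed.

Lemma standard_count0 V G x : x \in V ->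
  standard_count V G 0 = standard_count (V :\ x) G 0.
Proof.
move=> xV; rewrite /standard_count !count_monomials0 -on_vars_del //.
by rewrite mnm0E eqxx.
Qed.

(** Dimension count in 0 -> S/(J : x)(-1) -> S/J -> S/(J, x) -> 0 for the monomial ideal J of [G] in
    S = K[V]. *)
Lemma standard_countS V G x m : x \in V ->
  standard_count V G m.+1 = standard_count (V :\ x) G m.+1 + standard_count V (colon_mnm G x) m.
Proof.
move=> xV; rewrite /standard_count (count_monomialsS _ x); congr (_ + _).
  by apply: eq_count => u /=; rewrite andbA on_vars_del.
by apply: eq_count => u /=; rewrite on_vars_add // standard_colon.
Qed.

Lemma standard_count_nil V m : standard_count V [::] m = cone_hilb #|V| m.
Proof.
elim: {V}_.+1 {-2}V (ltnSn #|V|) m => // k IHk V Vk m.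
have [->|[x xV]] := set_0Vmem V.
  rewrite cards0 /= /standard_count; case: m => [|m].
    rewrite count_monomials0 andbT; apply/eqP; rewrite eqb1.
    by apply/on_varsP => i _; rewrite mnm0E.
  apply/eqP; rewrite [X in _ == X](_ : _ = 0) // -leqn0 leqNgt -has_count; apply/hasPn => u.
  rewrite mem_monomials andbT => /eqP um; apply/negP => /on_varsP u0.
  by move: um; rewrite mdegE big1 // => i _; rewrite u0 ?inE.
have Vx : #|V| = #|V :\ x|.+1 by rewrite (cardsD1 x) xV.
have Vk' : #|V :\ x| < k by rewrite -ltnS -Vx.
rewrite Vx; elim: m => [|m IHm].
  by rewrite (standard_count0 _ xV) IHk //; case: #|_| => [|j]; rewrite /= ?add0n ?binn.
rewrite (standard_countS _ _ xV) IHk //.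
by rewrite cone_hilb_rec addnC IHm.
Qed.

(** Independence of the variables [s] modulo the monomial ideal; the largest size of such a set is
    the dimension of the quotient. *)
Definition free_vars G s := ~~ has (on_vars s) G.

Lemma free_vars_colon G x s : free_vars (colon_mnm G x) s -> free_vars G s.
Proof.
apply: contraNN => /hasP[g gG /on_varsP gs]; apply/hasP.
exists (g - U_(x))%MM; first exact: map_f.
by apply/on_varsP => i /gs; rewrite mnmBE => ->.
Qed.

Lemma not_standard_on_vars V G u : on_vars V u -> free_vars G V -> standard_mnm G u.
Proof.
move=> /on_varsP uV; apply: contraNN => /hasP[g gG /mnm_lepP gu]; apply/hasP; exists g => //.
by apply/on_varsP => i /uV ui; apply/eqP; rewrite -leqn0 -ui.
Qed.

(* Splitting off a variable outside a free set [s] of maximal size: the part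
   not involving the variable has a cone of dimension [#|s|] in degree 0, which
   keeps the union 0-standard. *)
Lemma standard_decomposition V G : exists P : seq (nat * nat),
  [/\ standard 0 P, forall m, standard_count V G m = hilb P m,
      forall k, (forall s, s \subset V -> free_vars G s -> #|s| <= k) ->
        forall c : nat * nat, c \in P -> c.2 <= k,
      forall s, s \subset V -> free_vars G s ->
        exists2 c : nat * nat, c \in P & c.1 = 0 /\ #|s| <= c.2 &
      forall u, on_vars V u -> ~~ standard_mnm G u ->
        (forall i, u i != 0 -> standard_mnm G (u - U_(i))%MM) -> u != 0%MM ->
        exists2 c : nat * nat, c \in P & mdeg u <= c.1.+1].
Proof.
have [k] := ubnP (#|V| + \sum_(g <- G) mdeg g); elim: k V G => // k IHk V G VGk.
(* If the empty set is not free, then 1 is a generator and nothing is standard. *)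
have [free0|free0] := boolP (free_vars G finset.set0); last first.
  have {}free0 u : standard_mnm G u = false.
    apply: contraNF free0 => /hasPn h; apply/hasPn => g /h; apply: contraNN => /on_varsP g0.
    by apply/mnm_lepP => i; rewrite g0 ?inE.
  exists [::]; split=> // [m|s sV sG|u _ _ ui u0].
  - by rewrite /hilb big_nil; apply/eqP; rewrite -leqn0 leqNgt -has_count;
      apply/hasPn => u _; rewrite free0 andbF.
  - have := @not_standard_on_vars s G 0%MM _ sG; rewrite free0 => h.
    by suff: false by []; apply: h; apply/on_varsP => i _; rewrite mnm0E.
  - by have [i /ui] := mnm_neq0 u0; rewrite free0.
have [freeV|freeV] := boolP (free_vars G V).
  exists [:: (0, #|V|)]; split.
  - move=> c; rewrite inE => /eqP -> /= _; split=> // e; rewrite leqn0 => /eqP ->.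
    by exists (0, #|V|); rewrite ?mem_head.
  - move=> m; rewrite /hilb big_seq1 /shifted_hilb /= subn0 -standard_count_nil.
    apply: eq_count => u; rewrite [standard_mnm [::] u]isT andbT.
    by apply/andb_idr => /not_standard_on_vars; apply.
  - by move=> j Vj c; rewrite inE => /eqP ->; apply: Vj.
  - by move=> s sV _; exists (0, #|V|); rewrite ?mem_head // subset_leq_card.
  - by move=> u uV; rewrite (not_standard_on_vars uV freeV).
pose Pfree := [pred s : {set 'I_n} | (s \subset V) && free_vars G s].
have Pfree0 : Pfree finset.set0 by rewrite /= finset.sub0set.
case: (arg_maxnP (fun s : {set 'I_n} => #|s|) Pfree0) => s /andP[sV sG] smax.
have [x xV xs] : exists2 x, x \in V & x \notin s.
  apply/subsetPn; apply: contraNN freeV => Vs.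
  by have -> : V = s by apply/eqP; rewrite finset.eqEsubset Vs.
have sVx : s \subset V :\ x by rewrite finset.subsetD1 sV.
(* Maximality of [s] forces [x] into some generator, so passing to the colon ideal lowers the total
   degree of the generators, while deleting [x] lowers #|V|; this is the induction measure. *)
have [g gG gx] : exists2 g, g \in G & g x != 0.
  have : ~~ free_vars G (x |: s).
    apply/negP => xsG; have := smax (x |: s); rewrite /= xsG finset.subUset finset.sub1set xV sV /=.
    by rewrite cardsU1 xs add1n => /(_ isT); rewrite /= ltnn.
  rewrite negbK => /hasP[g gG /on_varsP gxs]; exists g => //.
  apply: contraNN sG => /eqP gx; apply/hasP; exists g => //; apply/on_varsP => i si.
  by have [->//|ix] := eqVneq i x; apply: gxs; rewrite !inE negb_or ix.
have [|P1 [std1 hilb1 dim1 deg1 gen1]] := IHk (V :\ x) G.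
  by rewrite -ltnS; apply: leq_trans VGk; rewrite (cardsD1 x V) xV.
have [|P2 [std2 hilb2 dim2 deg2 gen2]] := IHk V (colon_mnm G x).
  rewrite -ltnS; apply: leq_ltn_trans VGk; rewrite ltn_add2l big_map !(big_rem g gG) /=.
  apply: (@leq_trans (mdeg g + \sum_(y <- rem g G) mdeg (y - U_(x))%MM)); last first.
    by rewrite leq_add2l; apply: leq_sum => y _; exact: mdegB.
  rewrite -addSn leq_add2r.
  have le_g : (U_(x) <= g)%MM by rewrite lep1mP.
  by rewrite -{2}(submK le_g) mdegD mdeg1 addn1.
have dim2s c : c \in P2 -> c.2 <= #|s|.
  apply: dim2 => s' s'V s'G; apply: smax; rewrite /= s'V.
  exact: free_vars_colon s'G.
have [c0 c0P [c01 c02]] := deg1 s sVx sG.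
exists (P1 ++ [seq (c.1.+1, c.2) | c <- P2]); split.
- move=> c; rewrite mem_cat => /orP[cP|/mapP[c2 cP ->]] /= c0_lt.
    have [_ ex] := std1 c cP c0_lt; split=> // e /ex[c' c'P cc'].
    by exists c'; rewrite // mem_cat c'P.
  split=> // -[_|e ec]; first by exists c0; rewrite ?mem_cat ?c0P // (leq_trans (dim2s _ cP)).
  have [_ /(_ e ec)[c' c'P [c'1 cc']]] := std2 _ cP c0_lt.
  exists (c'.1.+1, c'.2); rewrite /= ?c'1 // mem_cat; apply/orP; right.
  by apply/mapP; exists c'; rewrite // c'1.
- case=> [|m].
    rewrite (standard_count0 _ xV) hilb1 hilb_cat [X in _ + X]/hilb big_map.
    by rewrite big1 ?addn0 // => c _.
  by rewrite (standard_countS _ _ xV) hilb1 hilb2 hilb_cat; congr (_ + _); rewrite /hilb big_map.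
- move=> j sj c; rewrite mem_cat => /orP[|/mapP[c2 cP ->]] /=.
    by apply: dim1 => s' s'V; apply: sj; apply: subset_trans s'V (finset.subsetDl _ _).
  exact: leq_trans (dim2s _ cP) (sj s sV sG).
- move=> s' s'V s'G; exists c0; first by rewrite mem_cat c0P.
  by split=> //; apply: leq_trans c02; apply: smax; rewrite /= s'V.
(* A minimal generator either avoids [x], or its quotient by [x] is 1 or a minimal generator of the
   colon ideal, whose cones are shifted by one degree. *)
- move=> u uV uG ui u0; have [ux|ux] := eqVneq (u x) 0.
    have [||||c cP uc] := gen1 u => //; first by rewrite -on_vars_del // ux eqxx.
    by exists c; rewrite // mem_cat cP.
  have le_u : (U_(x) <= u)%MM by rewrite lep1mP.
  have uE : u = (U_(x) + (u - U_(x)))%MM by rewrite addmC submK.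
  have udeg : mdeg u = (mdeg (u - U_(x))).+1 by rewrite {1}uE mdegD mdeg1.
  have [u'0|u'0] := eqVneq (u - U_(x))%MM 0%MM.
    by exists c0; rewrite ?mem_cat ?c0P // udeg u'0 mdeg0.
  have [||i ui'|//|c cP uc] := gen2 (u - U_(x))%MM.
  - by rewrite -(on_vars_add _ xV) -uE.
  - by rewrite standard_colon -uE.
  - rewrite standard_colon; have -> : (U_(x) + (u - U_(x) - U_(i)) = u - U_(i))%MM.
      apply/mnmP => j; rewrite mnmDE !mnmBE !mnm1E.
      have [<-{j}|_] := eqVneq x j; last by rewrite add0n subn0.
      move: ui' ux; rewrite mnmBE mnm1E (eq_sym x i).
      have [->|_] := eqVneq i x; first by move: (u x); clear; lia.
      by move=> _; move: (u x); clear; lia.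
    by apply: ui; apply: contraNN ui'; rewrite mnmBE => /eqP ->.
  exists (c.1.+1, c.2); last by rewrite udeg.
  by rewrite mem_cat; apply/orP; right; apply/mapP; exists c.
Qed.

(** In a nonzero ideal some generator involves only the full set of variables, which is thus not
    free; hence [n.-1]. The monomial [v] is reached from [u] by dividing by variables as long as the
    quotient stays in [M]. *)
Lemma monomial_ideal_cones (M : pred 'X_{1..n}) :
  (forall u i, M u -> M (U_(i) + u)%MM) -> exists P : seq (nat * nat),
  [/\ standard 0 P, forall m, count (predC M) (monomials m) = hilb P m,
      (exists u, M u) -> forall c : nat * nat, c \in P -> c.2 <= n.-1 &
      forall u, M u -> exists v, [/\ M v, (v <= u)%MM &
        v = 0%MM \/ exists2 c : nat * nat, c \in P & mdeg v <= c.1.+1]].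
Proof.
move=> Mup; have [G [GM Gu]] := dickson M.
have M_add u v : M u -> M (v + u)%MM.
  move=> Mu; elim/ltn_ind: {v}_.+1 {-2}v (ltnSn (mdeg v)) => k IHk v vk.
  have [->|/mnm_neq0[i vi]] := eqVneq v 0%MM; first by rewrite add0m.
  have le_v : (U_(i) <= v)%MM by rewrite lep1mP.
  rewrite -(submK le_v) [X in (X + u)%MM]addmC -addmA; apply: Mup.
  apply: (IHk (mdeg (v - U_(i))).+1) => //.
  by apply: leq_trans vk; rewrite -{2}(submK le_v) mdegD mdeg1 addn1.
have standardE u : standard_mnm G u = ~~ M u.
  congr (~~ _); apply/hasP/idP => [[g /GM Mg gu]|/Gu[g gG gu]]; last by exists g.
  by rewrite -(submK gu) M_add.
have on_varsT u : on_vars [set: 'I_n]%SET u by apply/on_varsP => i; rewrite !inE.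
have [P [P1 P2 P3 P4 P5]] := standard_decomposition [set: 'I_n]%SET G.
exists P; split=> // [m|[u Mu] c cP|].
- by rewrite -P2; apply: eq_count => u; rewrite on_varsT standardE.
- apply: (P3 n.-1) cP => s _ sG; suff : #|s| < n by case: (n) (#|s|).
  rewrite -[X in _ < X]card_ord -cardsT; apply: proper_card; rewrite properT.
  apply: contraTneq sG => ->; rewrite negbK; have [g gG _] := Gu u Mu.
  by apply/hasP; exists g.
move=> u; elim/ltn_ind: {u}_.+1 {-2}u (ltnSn (mdeg u)) => k IHk u uk Mu.
have [ue0|u0] := eqVneq u 0%MM; first by exists u; split; [|exact: lepm_refl|left].
have [/existsP[i /andP[ui Mui]]|] := boolP [exists i, (u i != 0) && M (u - U_(i))%MM].
  have le_u : (U_(i) <= u)%MM by rewrite lep1mP.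
  have v_lt : (mdeg (u - U_(i))%MM).+1 < k.
    by apply: leq_ltn_trans uk; rewrite -{2}(submK le_u) mdegD mdeg1 addn1.
  have [v [Mv vu vP]] := IHk _ v_lt _ (ltnSn _) Mui.
  by exists v; split=> //; apply: lepm_trans vu (lem_subr _ _).
rewrite negb_exists => /forallP u_min; exists u; split; rewrite ?lepm_refl //; right.
apply: P5 => // [|i ui]; first by rewrite standardE negbK.
by rewrite standardE; have := u_min i; rewrite ui.
Qed.

End Monomials.

(** * Homogeneous components of ideals *)

Section HomogeneousComponents.
Variables (N : nat) (F : fieldType).
Local Notation H := (dhomog N.+1 F).
Implicit Types (m : nat) (u : 'X_{1..N.+1}) (p f : {mpoly F[N.+1]}).

Lemma homog_eq0 m (p : H m) : (p == 0) = ((p : {mpoly F[N.+1]}) == 0).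
Proof. by rewrite -(inj_eq val_inj). Qed.

Definition hcoeff m u (p : H m) : F^o := (p : {mpoly F[N.+1]})@_u.

Lemma hcoeff_is_linear m u : linear (@hcoeff m u).
Proof. by move=> a p q; rewrite /hcoeff /= mcoeffD mcoeffZ. Qed.

HB.instance Definition _ m u :=
  GRing.isLinear.Build F (H m) F^o _ (@hcoeff m u) (@hcoeff_is_linear m u).

Lemma dim_coeff_kernel m (V : {vspace H m}) u (p : H m) : p \in V -> hcoeff u p != 0 ->
  \dim V = (\dim (V :&: lker (linfun (@hcoeff m u)))).+1.
Proof.
move=> pV pu; rewrite -(limg_ker_dim (linfun (@hcoeff m u)) V) -addn1; congr (_ + _)%N.
apply/anti_leq; rewrite (leq_trans (dimvS (subvf _))) ?dimvf //=.
rewrite lt0n dimv_eq0; apply: contraNneq pu => V0.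
by have := memv_img (linfun (@hcoeff m u)) pV; rewrite V0 memv0 lfunE.
Qed.

Lemma mem_coeff_kernel m (V : {vspace H m}) u (p : H m) :
  (p \in (V :&: lker (linfun (@hcoeff m u)))%VS) = (p \in V) && (hcoeff u p == 0).
Proof. by rewrite memv_cap memv_ker lfunE. Qed.

Definition is_lead m (V : {vspace H m}) : pred 'X_{1..N.+1} :=
  fun u => `[< exists2 p : H m, p \in V & (p : {mpoly F[N.+1]}) != 0 /\ mlead p = u >].

(** Cutting [V] by the vanishing of the coefficient at the leading monomial of one element lowers
    the dimension by one and removes exactly that leading monomial. *)
Lemma count_leads m (V : {vspace H m}) : count (is_lead V) (monomials N.+1 m) = \dim V.
Proof.
move Er: (\dim V) => r; elim: r V Er => [|r IHr] V Er.
  apply/eqP; rewrite -leqn0 leqNgt -has_count; apply/hasPn => u _; apply/asboolP => -[p pV [p0 _]].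
  by move: pV; rewrite (eqP (_ : V == 0%VS)) -?dimv_eq0 ?Er // memv0 homog_eq0 (negPf p0).
have : vpick V != 0 by rewrite vpick0 -dimv_eq0 Er.
have : vpick V \in V by exact: memv_pick.
move: (vpick V) => f fV f0.
rewrite homog_eq0 in f0.
pose u := mlead f; have fu : hcoeff u f != 0 by rewrite /hcoeff mleadc_eq0.
have := dim_coeff_kernel fV fu; rewrite Er => -[/esym/IHr].
set V' := (V :&: _)%VS; move=> <-.
have mem_V' (p : H m) : (p \in V') = (p \in V) && (hcoeff u p == 0) by exact: mem_coeff_kernel.
have leadE v : is_lead V v = (v == u) || is_lead V' v.
  apply/asboolP/orP => [[p pV [p0 pv]]|[/eqP ->|/asboolP[p]]]; first last.
  - by rewrite mem_V' => /andP[pV _] pv; exists p.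
  - by exists f.
  have [->|vu] := eqVneq v u; [by left|right; apply/asboolP].
  have [uv|uv|uv] := ltgtP u v; last by rewrite uv eqxx in vu.
    exists (p - (hcoeff u p / hcoeff u f) *: f).
      rewrite mem_V' memvB ?memvZ //= linearB linearZ /= -[_ *: _]/(_ * _).
      by rewrite divfK ?subrr.
    have lead_p : mlead (p - (hcoeff u p / hcoeff u f) *: f : {mpoly F[N.+1]}) = v.
      rewrite mleadDl ?mleadN // pv; apply: le_lt_trans uv; exact: mleadZ_le.
    split=> //; apply: contraTneq (uv) => e0.
    have -> : v = 0%MM by rewrite -lead_p -[RHS](mlead0 N.+1 F); exact: (congr1 (@mlead _ _) e0).
    by rewrite ltx0.
  exists p => //; rewrite mem_V' pV /= /hcoeff mcoeff_gt_mlead //.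
  by rewrite pv.
have lead_u : is_lead V' u = false.
  apply/asboolP => -[p]; rewrite mem_V' => /andP[_ pu] [p0 pl].
  by move: pu; rewrite /hcoeff -pl mleadc_eq0 (negPf p0).
have := count_predUI (pred1 u) (is_lead V') (monomials N.+1 m).
rewrite [count (predI _ _) _](_ : _ = 0%N) ?addn0; last first.
  apply/eqP; rewrite -leqn0 leqNgt -has_count; apply/hasPn => v _ /=.
  by apply/negP => /andP[/eqP ->]; rewrite lead_u.
rewrite count_uniq_mem ?uniq_monomials // mem_monomials.
rewrite (dhomog_mf (dhomog_is_dhomog f)) ?mlead_supp // eqxx add1n => <-.
exact: eq_count.
Qed.

(* Multiplication by [f] followed by projection to degree [b]; used when [f] is
   homogeneous of degree [b - a]. *)
Definition hmul_fun f a b (p : H a) : H b := DHomog (pihomogP mdeg b (f * p)).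

Lemma hmul_fun_is_linear f a b : linear (@hmul_fun f a b).
Proof.
move=> c p q; apply/val_inj => /=.
by rewrite mulrDr -scalerAr linearP.
Qed.

HB.instance Definition _ f a b :=
  GRing.isLinear.Build F (H a) (H b) _ (@hmul_fun f a b) (@hmul_fun_is_linear f a b).

Definition hmul f a b : 'Hom(H a, H b) := linfun (@hmul_fun f a b).

Lemma hmulE f e a b (p : H a) : f \is e.-homog -> (e + a)%N = b ->
  hmul f a b p = f * p :> {mpoly F[N.+1]}.
Proof.
move=> fe eab; rewrite lfunE /= pihomog_dE // -eab.
by apply: dhomogM => //; exact: dhomog_is_dhomog.
Qed.

(** A homogeneous ideal given by its components; closure under the variables replaces closure under
    all polynomials. *)
Definition graded (W : forall m, {vspace H m}) : Prop :=
  forall m i (p : H m), p \in W m -> hmul 'X_i m m.+1 p \in W m.+1.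

Definition leads (W : forall m, {vspace H m}) : pred 'X_{1..N.+1} :=
  fun u => is_lead (W (mdeg u)) u.

Lemma count_graded_leads W m :
  count (leads W) (monomials N.+1 m) = \dim (W m).
Proof.
rewrite -count_leads; apply: eq_in_count => u.
by rewrite mem_monomials /leads => /eqP ->.
Qed.

Lemma mpolyX_dhomog (i : 'I_N.+1) : ('X_i : {mpoly F[N.+1]}) \is 1.-homog.
Proof. by rewrite dhomogX /= mdeg1. Qed.

Lemma leads_mul W u i : graded W -> leads W u -> leads W (U_(i) + u)%MM.
Proof.
move=> gW /asboolP[p pW [p0 pu]]; rewrite /leads mdegD mdeg1 add1n; apply/asboolP.
exists (hmul 'X_i _ _ p); first exact: gW.
rewrite (hmulE _ (mpolyX_dhomog i)) ?add1n //; split.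
  by rewrite mulf_neq0 // -msupp_eq0 msuppX.
rewrite mleadM_proper ?mleadXm ?pu //.
by rewrite mcoeffX eqxx mul1r -[X in p@_X]pu mleadc_eq0.
Qed.

Lemma size_monomials m : size (monomials N.+1 m) = cone_hilb N.+1 m.
Proof.
have := standard_count_nil [set: 'I_N.+1]%SET m; rewrite cardsT card_ord => <-.
rewrite -count_predT; apply: eq_count => u; rewrite [standard_mnm [::] u]isT andbT.
by apply/esym/on_varsP => i; rewrite !inE.
Qed.

Lemma dim_homog m : \dim {: H m} = cone_hilb N.+1 m.
Proof. by rewrite dimvf -[LHS]/('C(m + N, m)) -bin_sub ?leq_addr // addKn. Qed.

(** Macaulay's theorem: the leading monomials form a monomial ideal with the same Hilbert function.
    It serves both for in_w(I) and for the colon ideals met when adjoining generators. *)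
Lemma graded_cones W : graded W -> exists P : seq (nat * nat),
  [/\ standard 0 P, forall m, (\dim (W m) + hilb P m)%N = cone_hilb N.+1 m,
      (exists m, W m != 0%VS) -> forall c : nat * nat, c \in P -> (c.2 <= N)%N &
      forall u, leads W u -> exists v, [/\ leads W v, (v <= u)%MM &
        v = 0%MM \/ exists2 c : nat * nat, c \in P & (mdeg v <= c.1.+1)%N]].
Proof.
move=> gW; have [P [P1 P2 P3 P4]] := monomial_ideal_cones (fun u i => @leads_mul W u i gW).
exists P; split=> // [m|[m Wm]].
  by rewrite -P2 -count_graded_leads count_predC size_monomials.
apply: P3; have : has (leads W) (monomials N.+1 m).
  by rewrite has_count count_graded_leads lt0n dimv_eq0.
by case/hasP => u _ lu; exists u.
Qed.

(** * Adjoining generators one at a time through colon ideals *)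

Fixpoint gen_comp (fs : seq {mpoly F[N.+1]}) m : {vspace H m} :=
  if fs is f :: fs' then
    (gen_comp fs' m +
     if (mpdeg f <= m)%N then limg (hmul f (m - mpdeg f) m) else 0)%VS
  else 0%VS.

Definition homog_nz f := (f != 0) && (f \is (mpdeg f).-homog).

Lemma gen_comp_mul fs f m (q : H (m - mpdeg f)) (p : H m) : f \in fs ->
  homog_nz f -> (mpdeg f <= m)%N -> val p = f * q -> p \in gen_comp fs m.
Proof.
move=> + /andP[_ fe] fm pE; elim: fs => //= g fs IH; rewrite inE => /predU1P[<-|/IH ps].
  have -> : p = hmul f (m - mpdeg f) m q.
    by apply: val_inj; rewrite pE; rewrite [RHS](hmulE _ fe) // subnKC.
  by rewrite fm; apply: subvP (addvSr _ _) _ (memv_img _ (memvf _)).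
by apply: subvP (addvSl _ _) _ ps.
Qed.

Lemma gen_comp_graded fs : all homog_nz fs -> graded (gen_comp fs).
Proof.
move=> fsP m i p; elim: fs fsP p => [_ p|f fs IH /= /andP[/andP[f0 fe] fsP] p].
  by rewrite !memv0 => /eqP ->; rewrite linear0.
case/memv_addP => p1 p1J [p2 p2J ->]; rewrite linearD /=; apply: memv_add; first exact: IH.
move: p2J; case: leqP => [fm|_]; last first.
  by rewrite memv0 => /eqP ->; rewrite linear0; exact: mem0v.
case/memv_imgP => q _ ->; rewrite leqW //.
have -> : hmul 'X_i m m.+1 (hmul f (m - mpdeg f) m q) =
    hmul f (m.+1 - mpdeg f) m.+1 (hmul 'X_i (m - mpdeg f) (m.+1 - mpdeg f) q).
  apply: val_inj; rewrite /= (hmulE _ (mpolyX_dhomog i)) ?add1n //.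
  rewrite (hmulE _ fe) ?subnKC // (hmulE _ fe) ?subnKC ?leqW //.
  by rewrite (hmulE _ (mpolyX_dhomog i)) ?add1n ?subSn // mulrCA.
exact: memv_img (memvf _).
Qed.

Definition colon_comp fs f a : {vspace H a} :=
  (hmul f a (mpdeg f + a) @^-1: gen_comp fs (mpdeg f + a))%VS.

Lemma mem_colon_comp fs f a b (p : H a) : (mpdeg f + a)%N = b ->
  (p \in colon_comp fs f a) = (hmul f a b p \in gen_comp fs b).
Proof. by move=> <-; rewrite -memv_preim. Qed.

Lemma colon_comp_graded fs f : all homog_nz fs -> homog_nz f -> graded (colon_comp fs f).
Proof.
move=> fsP /andP[f0 fe] a i p; rewrite (mem_colon_comp _ _ (erefl _)) => pJ.
rewrite (mem_colon_comp _ _ (addnS _ _)).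
suff -> : hmul f a.+1 (mpdeg f + a).+1 (hmul 'X_i a a.+1 p) =
    hmul 'X_i (mpdeg f + a) (mpdeg f + a).+1 (hmul f a (mpdeg f + a) p).
  exact: gen_comp_graded.
apply: val_inj; rewrite /= (hmulE _ fe) ?addnS // (hmulE _ (mpolyX_dhomog i)) ?add1n //.
by rewrite (hmulE _ (mpolyX_dhomog i)) ?add1n // (hmulE _ fe) // mulrCA.
Qed.

Lemma hmul_inj f e a b : f != 0 -> f \is e.-homog -> (e + a)%N = b -> lker (hmul f a b) = 0%VS.
Proof.
move=> f0 fe eab; apply/eqP/lker0P => p q /(congr1 val) /=.
by rewrite !(hmulE _ fe eab) => /(mulfI f0) /val_inj.
Qed.

(** Multiplication by [f] is injective and carries the component of the colon ideal onto the
    intersection with the multiples of [f]; the rest is the dimension formula for a sum of two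
    subspaces. *)
Lemma dim_gen_comp_cons fs f a : homog_nz f ->
  (\dim (gen_comp (f :: fs) (mpdeg f + a)) + \dim (colon_comp fs f a) =
   \dim (gen_comp fs (mpdeg f + a)) + \dim {: H a})%N.
Proof.
move=> /andP[f0 fe]; rewrite /= leq_addr addKn.
set J := gen_comp fs _; set h := hmul f a _.
have h0 V : \dim (h @: V) = \dim V.
  by rewrite limg_dim_eq // (hmul_inj f0 fe (erefl _)) capv0.
rewrite -(h0 fullv) -dimv_sum_cap; congr (_ + _)%N.
rewrite -[in LHS]h0; congr (\dim _); apply/eqP; rewrite eqEsubv.
apply/andP; split; last first.
  apply/subvP => q; rewrite memv_cap => /andP[qJ /memv_imgP[p _ qE]].
  by rewrite qE memv_img // -memv_preim -qE.
apply/subvP => _ /memv_imgP[p pC ->]; rewrite memv_cap memv_img ?memvf // andbT.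
by rewrite memv_preim.
Qed.

(** The list ends with [f1] so that the recursion starts from a nonzero principal ideal, whose cone,
    lifted to degree [d], is the only one of full dimension. Each further [f] adds the quotient by a
    colon ideal, shifted by the degree of [f] and lifted from there to [d]. *)
Lemma gen_comp_cones fs f1 d : all homog_nz fs -> homog_nz f1 ->
  all (fun f => mpdeg f <= d)%N fs -> (mpdeg f1 <= d)%N ->
  exists P : seq (nat * nat),
  [/\ standard d P, forall c : nat * nat, c \in P -> (c.2 <= N)%N &
      forall m, \dim (gen_comp (rcons fs f1) m) = (shifted_hilb (d, N.+1) m + hilb P m)%N].
Proof.
move=> + f1P + f1d; elim: fs => [_ _|f fs IH /= /andP[fP fsP] /andP[fd fsd]].
  have [|L [L1 L2]] := @cone_lift N (mpdeg f1) d d; first by rewrite f1d leqnn.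
  exists L; split=> [c cL c2|c /L1[]//|m].
    have [_ /(_ c2) c1] := L1 c cL; split=> [|e]; rewrite c1 // => ed.
    by exists c => //; split=> //; rewrite c1; exact: anti_leq.
  rewrite -L2 /shifted_hilb [(_, _).1]/=; case: leqP => [fm|fm]; last first.
    by rewrite /= leqNgt fm addv0 dimv0.
  have := @dim_gen_comp_cons [::] f1 (m - mpdeg f1) f1P.
  rewrite subnKC // [gen_comp [::] _]/= dimv0 add0n dim_homog.
  rewrite [colon_comp _ _ _](_ : _ = 0%VS) ?dimv0 ?addn0 //.
  have /andP[f0 fe] := f1P.
  apply/eqP; rewrite -subv0; apply/subvP => p; rewrite (mem_colon_comp _ _ (erefl _)) /= memv0.
  by rewrite memv0 !homog_eq0 (hmulE _ fe) // mulf_eq0 (negPf f0).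
have fsP' : all homog_nz (rcons fs f1) by rewrite all_rcons f1P.
have [P [P1 P2 P3]] := IH fsP fsd.
have [Q [Q1 Q4 Q3 _]] := graded_cones (colon_comp_graded fsP' fP).
pose Qs := [seq ((c.1 + mpdeg f)%N, c.2) | c : nat * nat <- Q].
have stdQs : standard (mpdeg f) Qs.
  move=> _ /mapP[c cQ ->] /= c2; have [_ ex] := Q1 c cQ c2; split=> [|e ec]; first exact: leq_addl.
  have [|c' c'Q [c'1 cc']] := ex (e - mpdeg f)%N; first by rewrite leq_subLR addnC; case/andP: ec.
  exists ((c'.1 + mpdeg f)%N, c'.2); first by apply/mapP; exists c'.
  by rewrite /= c'1 subnK //; case/andP: ec.
have dimQs (c : nat * nat) : c \in Qs -> (c.2 <= N)%N.
  case/mapP => c' c'Q -> /=; apply: Q3 c'Q.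
  (* The product [f * f1] lies in the ideal, so the colon ideal contains [f1] and is nonzero. *)
  exists (mpdeg f1); have /andP[f10 f1e] := f1P; have /andP[f0 fe] := fP.
  have : DHomog f1e \in colon_comp (rcons fs f1) f (mpdeg f1).
    rewrite (mem_colon_comp _ _ (erefl _)).
    have fe' : f \is (mpdeg f + mpdeg f1 - mpdeg f1).-homog by rewrite addnK.
    apply: (gen_comp_mul (f := f1) (q := DHomog fe')); rewrite ?leq_addl //.
      by rewrite mem_rcons mem_head.
    by rewrite [LHS](hmulE _ fe) // mulrC.
  by apply: contraTneq => ->; rewrite memv0 homog_eq0 (negPf f10).
have [Q' [Q'1 Q'2 Q'3]] := standard_lift stdQs fd dimQs.
exists (P ++ Q'); split=> [|c|m]; first exact: standard_cat.
  by rewrite mem_cat => /orP[/P2|/Q'2].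
rewrite hilb_cat addnA -P3 -Q'1.
have -> : hilb Qs m = if (mpdeg f <= m)%N then hilb Q (m - mpdeg f) else 0%N.
  rewrite /hilb /Qs big_map; case: leqP => [fm|fm].
    by apply: eq_bigr => c _; rewrite /shifted_hilb /= addnC subnDA leq_subRL.
  rewrite big1 // => c _; rewrite /shifted_hilb /= leqNgt.
  by rewrite (leq_trans fm) // leq_addl.
case: leqP => [fm|_]; last by rewrite addv0 addn0.
have := @dim_gen_comp_cons (rcons fs f1) f (m - mpdeg f) fP.
rewrite subnKC //= fm dim_homog => e; apply/eqP.
rewrite -(eqn_add2r (\dim (colon_comp (rcons fs f1) f (m - mpdeg f)))) e -addnA eqn_add2l.
by rewrite addnC Q4.
Qed.
End HomogeneousComponents.

(** * Initial forms *)

Section Residue.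
Variables (R : realType) (K : fieldType) (v : valuation R K).
Local Notation k := (residue_field v).

(** Encodes the convention that 0 has infinite valuation, the real [v 0] being arbitrary. *)
Definition val_ge (b : R) (c : K) : bool := (c == 0) || (b <= v c).

Lemma val_ge0 b : val_ge b 0.
Proof. by rewrite /val_ge eqxx. Qed.

Lemma val_geD b c1 c2 : val_ge b c1 -> val_ge b c2 -> val_ge b (c1 + c2).
Proof.
rewrite /val_ge; have [-> _|c10 /= b1] := eqVneq c1 0; first by rewrite add0r.
have [->|c20 /= b2] := eqVneq c2 0; first by rewrite addr0 b1 orbT.
have [//|c120] := eqVneq (c1 + c2) 0.
by apply: le_trans (valuationD v c10 c20 c120); rewrite le_min b1.
Qed.

Lemma val_geM b1 b2 c1 c2 : val_ge b1 c1 -> val_ge b2 c2 -> val_ge (b1 + b2) (c1 * c2).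
Proof.
rewrite /val_ge mulf_eq0; have [//|c10 /= bc1] := eqVneq c1 0.
by have [//|c20 /= bc2] := eqVneq c2 0; rewrite valuationM // lerD.
Qed.

Lemma val_geN b c : val_ge b (- c) = val_ge b c.
Proof. by rewrite /val_ge oppr_eq0; case: eqVneq => //= c0; rewrite valN. Qed.

Lemma val_ge_sum b (I : Type) (s : seq I) (P : pred I) (F : I -> K) :
  (forall i, P i -> val_ge b (F i)) -> val_ge b (\sum_(i <- s | P i) F i).
Proof. by move=> Fb; elim/big_ind: _ => //; [exact: val_ge0|exact: val_geD]. Qed.

Lemma val_geE b c : c != 0 -> val_ge b c = (b <= v c).
Proof. by rewrite /val_ge => /negPf ->. Qed.

Lemma valV c : c != 0 -> v c^-1 = - v c.
Proof.
move=> c0; have := valuationM v c0 (invr_neq0 c0); rewrite mulfV // Defs.val1 => /esym/eqP.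
by rewrite addrC addr_eq0 => /eqP.
Qed.

Lemma insub_valring a : val_ge 0 a -> val (insubd (0 : valring v) a) = a.
Proof. by move=> va; rewrite val_insubd unfold_in ifT. Qed.

Lemma residueD a b : val_ge 0 a -> val_ge 0 b -> residue v (a + b) = residue v a + residue v b.
Proof.
move=> a0 b0; rewrite /residue -[RHS]pi_addr; congr (\pi_(_) _)%qT.
by apply: val_inj; rewrite rmorphD /= !insub_valring // val_geD.
Qed.

Lemma residueM a b : val_ge 0 a -> val_ge 0 b -> residue v (a * b) = residue v a * residue v b.
Proof.
move=> a0 b0; rewrite /residue -[RHS]pi_mulr; congr (\pi_(_) _)%qT.
apply: val_inj; rewrite rmorphM /= !insub_valring //.
by rewrite -[0]addr0 val_geM.
Qed.

Lemma residue1 : residue v 1 = 1.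
Proof.
rewrite /residue -[RHS]pi_oner; congr (\pi_(_) _)%qT.
by apply: val_inj; rewrite insub_valring ?rmorph1 // /val_ge Defs.val1 lexx orbT.
Qed.

Lemma residue_eq0P a : val_ge 0 a -> (residue v a == 0) = (a == 0) || (0 < v a).
Proof.
move=> a0; rewrite /residue residue_eq0 unfold_in /in_maxideal.
by rewrite -(inj_eq val_inj) insub_valring // rmorph0.
Qed.

Variables (t : R -> K) (ht : splitting v t).

Lemma value_group_val c : c != 0 -> value_group v (v c).
Proof. by move=> c0; exists c. Qed.

Lemma value_group_valN c : c != 0 -> value_group v (- v c).
Proof. by move=> c0; exists c^-1; rewrite /= ?valV ?invr_neq0. Qed.

Lemma splitting0 : t 0 = 1.
Proof.
have g0 : value_group v 0 by rewrite -(Defs.val1 v); apply: value_group_val (oner_neq0 K).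
have := splittingD ht g0 g0; rewrite addr0 -{1}[t 0]mulr1.
by move/(mulfI (splitting_neq0 ht g0)).
Qed.

(* The residue of [t ^ -b * c] for [c] of valuation at least [b], extended by 0
   to the case where [b] is not in the value group. *)
Definition residue_at (b : R) (c : K) : k :=
  if (c != 0) && (v c == b) then residue v (t (- v c) * c) else 0.

Lemma residue_at0 b : residue_at b 0 = 0.
Proof. by rewrite /residue_at eqxx. Qed.

Lemma splitting_mul_ge b c : value_group v (- b) -> val_ge b c -> val_ge 0 (t (- b) * c).
Proof.
move=> gb bc; rewrite -(addNr b); apply: val_geM => //.
by rewrite val_geE ?(splitting_neq0 ht) // (splittingK ht).
Qed.

Lemma residue_atE b c : value_group v (- b) -> val_ge b c ->
  residue_at b c = residue v (t (- b) * c).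
Proof.
move=> gb bc; rewrite /residue_at; case: ifPn => [/andP[_ /eqP ->] //|].
rewrite negb_and negbK => h; apply/esym/eqP; rewrite residue_eq0P ?splitting_mul_ge //.
have tb := splitting_neq0 ht gb; rewrite mulf_eq0 (negPf tb) /=.
move: bc h; rewrite /val_ge; have [//|c0 /= bc cb] := eqVneq c 0.
by rewrite valuationM // (splittingK ht) // addrC subr_gt0 lt_neqAle eq_sym cb.
Qed.

Lemma residue_atD b c1 c2 : val_ge b c1 -> val_ge b c2 ->
  residue_at b (c1 + c2) = residue_at b c1 + residue_at b c2.
Proof.
move=> bc1 bc2; have [gb|gb] := pselect (value_group v (- b)).
  by rewrite !residue_atE ?val_geD // mulrDr residueD ?splitting_mul_ge.
have r0 c : residue_at b c = 0.
  rewrite /residue_at; case: ifP => // /andP[c0 /eqP cb].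
  by case: gb; rewrite -cb; exact: value_group_valN.
by rewrite !r0 addr0.
Qed.

Lemma residue_at_sum b (I : eqType) (s : seq I) (F : I -> K) :
  {in s, forall i, val_ge b (F i)} ->
  residue_at b (\sum_(i <- s) F i) = \sum_(i <- s) residue_at b (F i).
Proof.
elim: s => [|i s IH] Fb; first by rewrite !big_nil residue_at0.
have Fs : {in s, forall j, val_ge b (F j)} by move=> j js; rewrite Fb // inE js orbT.
rewrite !big_cons residue_atD ?IH // ?Fb ?mem_head // big_seq; exact: val_ge_sum.
Qed.

Lemma residue_atM b1 b2 c1 c2 : val_ge b1 c1 -> val_ge b2 c2 ->
  residue_at (b1 + b2) (c1 * c2) = residue_at b1 c1 * residue_at b2 c2.
Proof.
move=> bc1 bc2; rewrite /residue_at mulf_eq0 negb_or.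
have [->|c10] := eqVneq c1 0; first by rewrite /= ?eqxx /= mul0r.
have [->|c20] := eqVneq c2 0; first by rewrite /= mulr0.
rewrite /= valuationM //; move: bc1 bc2; rewrite !val_geE // => bc1 bc2.
have [e1|n1] := eqVneq (v c1) b1; last first.
  rewrite mul0r gt_eqF // ltr_leD // lt_neqAle eq_sym n1.
  exact: bc1.
have [e2|n2] := eqVneq (v c2) b2; last first.
  by rewrite mulr0 gt_eqF // ler_ltD // lt_neqAle eq_sym n2.
rewrite e1 e2 eqxx -residueM; first last.
- by apply: splitting_mul_ge; rewrite ?val_geE -?e2 //; exact: value_group_valN.
- by apply: splitting_mul_ge; rewrite ?val_geE -?e1 //; exact: value_group_valN.
rewrite opprD (splittingD ht); try by rewrite -?e1 -?e2; exact: value_group_valN.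
by rewrite mulrACA.
Qed.

Lemma residue_at_delta (e : bool) b : b = 0 \/ ~~ e -> residue_at b e%:R = e%:R.
Proof.
case: e => /= [[->|]|_] //; last by rewrite residue_at0.
by rewrite /residue_at oner_neq0 Defs.val1 eqxx oppr0 splitting0 mul1r residue1.
Qed.

Lemma residue_at_neq0 c : c != 0 -> residue_at (v c) c != 0.
Proof.
move=> c0; have gc := value_group_valN c0.
rewrite residue_atE ?val_geE // residue_eq0P ?splitting_mul_ge ?val_geE //.
rewrite mulf_eq0 (negPf (splitting_neq0 ht gc)) (negPf c0) /=.
by rewrite valuationM ?(splitting_neq0 ht) // (splittingK ht) // addNr ltxx.
Qed.

End Residue.

Section InitialForms.
Variables (R : realType) (K : fieldType) (v : valuation R K) (t : R -> K).
Hypothesis ht : splitting v t.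
Variables (n : nat) (w : 'rV[R]_n).
Local Notation k := (residue_field v).
Local Notation in_w := (initial_form v t w).
Local Notation mw := (min_weight v w).
Implicit Types (f g : {mpoly K[n]}) (x u : 'X_{1..n}).

Definition mnm_weight x : R := \sum_(i < n) w 0 i * (x i)%:R.

Lemma min_weight_le f x : f@_x != 0 -> mw f <= v f@_x + mnm_weight x.
Proof.
rewrite -mcoeff_msupp /min_weight -/(weight v w f x); elim: (msupp f) => // y s IH.
rewrite inE big_cons ge_min => /predU1P[->|/IH ->]; rewrite ?lexx ?orbT //.
Qed.

Lemma min_weight_attained f : f != 0 ->
  exists2 x, f@_x != 0 & mw f = v f@_x + mnm_weight x.
Proof.
move=> f0; have lf : f@_(mlead f) != 0 by rewrite mleadc_eq0.
suff [x xf e] : exists2 x, x \in mlead f :: msupp f & mw f = weight v w f x.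
  exists x => //; move: xf; rewrite inE => /predU1P[->//|]; by rewrite mcoeff_msupp.
rewrite /min_weight; elim: (msupp f) => [|y s [x xs e]].
  by exists (mlead f); rewrite ?mem_head // big_nil.
rewrite big_cons; case: (leP (weight v w f y)) => _.
  by exists y; rewrite // !inE eqxx orbT.
by exists x; rewrite // !inE; move: xs; rewrite inE => /orP[->|->]; rewrite ?orbT.
Qed.

Lemma min_weightP f x : f@_x != 0 ->
  (forall y, f@_y != 0 -> v f@_x + mnm_weight x <= v f@_y + mnm_weight y) ->
  mw f = v f@_x + mnm_weight x.
Proof.
move=> fx lb; apply/le_anti; rewrite min_weight_le //=.
have [|y fy ->] := @min_weight_attained f; last exact: lb.
by apply: contraNneq fx => ->; rewrite mcoeff0.
Qed.

Lemma mcoeff_initial_form f x : (in_w f)@_x = residue_at v t (mw f - mnm_weight x) f@_x.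
Proof.
rewrite /initial_form raddf_sum /= /residue_at.
rewrite (eq_bigr (fun u => if u == x then residue v (t (- v f@_u) * f@_u) else 0)); last first.
  by move=> u _; rewrite mcoeffZ mcoeffX; case: eqP; rewrite ?mulr1 ?mulr0.
rewrite -big_mkcondr /= big_mkcond /=.
have [fx|fx] := boolP (f@_x != 0); last first.
  rewrite big_seq big1 // => u uf; case: ifP => // /andP[_ /eqP ux].
  by move: uf; rewrite ux mcoeff_msupp (negPf fx).
rewrite (bigD1_seq x) ?mcoeff_msupp ?msupp_uniq //= eqxx andbT big1; last first.
  by move=> u /negPf ->; rewrite andbF.
rewrite addr0; suff -> : (v f@_x == mw f - mnm_weight x) = (weight v w f x == mw f) by [].
by rewrite eq_sym subr_eq eq_sym.
Qed.

Lemma val_ge_mcoeff f x : val_ge v (mw f - mnm_weight x) f@_x.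
Proof.
have [->|fx] := eqVneq f@_x 0; first exact: val_ge0.
by rewrite val_geE // lerBlDr min_weight_le.
Qed.

(** The hypothesis says that no summand has weight below that of [f], so no cancellation of lower
    terms occurs; summands of larger weight get the coefficient 0. *)
Lemma initial_form_sum (I : eqType) (s : seq I) (c : I -> K) (g : I -> {mpoly K[n]}) f :
  f = \sum_(i <- s) c i *: g i -> {in s, forall i, val_ge v (mw f - mw (g i)) (c i)} ->
  in_w f = \sum_(i <- s) residue_at v t (mw f - mw (g i)) (c i) *: in_w (g i).
Proof.
move=> fE cge; apply/mpolyP => x; rewrite mcoeff_initial_form [RHS]raddf_sum /=.
have e i : mw f - mnm_weight x = (mw f - mw (g i)) + (mw (g i) - mnm_weight x).
  by rewrite addrA subrK.
have -> : f@_x = \sum_(i <- s) c i * (g i)@_x.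
  by rewrite {1}fE raddf_sum; apply: eq_bigr => i _; rewrite /= mcoeffZ.
rewrite (residue_at_sum ht); last by move=> i i_s; rewrite (e i) val_geM ?cge // val_ge_mcoeff.
rewrite !big_seq; apply: eq_bigr => i i_s; rewrite mcoeffZ mcoeff_initial_form.
by rewrite -(residue_atM ht) ?val_ge_mcoeff ?cge // -e.
Qed.

Lemma initial_form_neq0 f : f != 0 -> in_w f != 0.
Proof.
case/min_weight_attained => x fx fE; apply/eqP => /(congr1 (mcoeff x)) /eqP.
by rewrite mcoeff0 mcoeff_initial_form fE addrK (negPf (residue_at_neq0 ht fx)).
Qed.

Lemma initial_form_homog f m : f \is m.-homog -> in_w f \is m.-homog.
Proof.
move=> fm; apply/dhomogP => x; rewrite mcoeff_msupp mcoeff_initial_form => h.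
apply: (dhomog_mf fm); rewrite mcoeff_msupp; apply: contraNneq h => ->.
by rewrite residue_at0.
Qed.

Lemma min_weightMX f u : f != 0 -> mw (f * 'X_[u]) = mw f + mnm_weight u.
Proof.
case/min_weight_attained => x fx fE.
have weightD y : mnm_weight (u + y)%MM = mnm_weight u + mnm_weight y.
  by rewrite -big_split /=; apply: eq_bigr => i _; rewrite mnmDE natrD mulrDr.
have c y : (f * 'X_[u])@_(u + y)%MM = f@_y by rewrite mcoeffMX.
rewrite (@min_weightP _ (u + x)%MM) c //; first by rewrite weightD fE; ring.
move=> y; have [uy|uy] := boolP (u <= y)%MM; last first.
  rewrite -mcoeff_msupp (perm_mem (msuppMX f u)) => /mapP[z _ yE].
  by move: uy; rewrite yE lem_addr.
rewrite -(submK uy) addmC c => fy; rewrite !weightD.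
have := min_weight_le fy; rewrite fE; lra.
Qed.

Lemma initial_formMX f u : f != 0 -> in_w (f * 'X_[u]) = in_w f * 'X_[u].
Proof.
move=> f0; apply/mpolyP => y; rewrite mcoeff_initial_form.
have [uy|uy] := boolP (u <= y)%MM; last first.
  have z (F : nzRingType) (p : {mpoly F[n]}) : (p * 'X_[u])@_y = 0.
    apply/eqP; rewrite mcoeff_eq0 (perm_mem (msuppMX p u)); apply/negP => /mapP[x _ yE].
    by move: uy; rewrite yE lem_addr.
  by rewrite !z residue_at0.
rewrite -(submK uy) addmC !mcoeffMX mcoeff_initial_form min_weightMX //; congr (residue_at _ _ _).
rewrite /mnm_weight; under [X in _ - X]eq_bigr => i _ do rewrite mnmDE natrD mulrDr.
by rewrite big_split /= -/(mnm_weight u); ring.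
Qed.

End InitialForms.

(** * Initial forms of one homogeneous component *)

Section InitialComponents.
Variables (R : realType) (K : fieldType) (v : valuation R K) (t : R -> K).
Hypothesis ht : splitting v t.
Variables (N : nat) (w : 'rV[R]_N.+1).
Local Notation k := (residue_field v).
Local Notation in_w := (initial_form v t w).
Local Notation mw := (min_weight v w).
Local Notation wt := (mnm_weight w).
Local Notation H := (dhomog N.+1 K).
Local Notation Hk := (dhomog N.+1 (residue_field v)).

(** Reduced echelon form, with the extra condition that the pivot, whose coefficient is 1, has
    minimal weight. Pivots thus survive in the initial forms, and every term of the expansion of [p]
    has weight at least that of [p]. *)
Definition pivot_basis m (V : {vspace H m}) (U : seq 'X_{1..N.+1}) (G : 'X_{1..N.+1} -> H m) :=
  [/\ uniq U, size U = \dim V,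
      forall u, u \in U -> G u \in V /\ mw (G u) = wt u,
      forall u u', u \in U -> u' \in U -> (G u : {mpoly K[N.+1]})@_u' = (u == u')%:R &
      forall p, p \in V -> p = \sum_(u <- U) (p : {mpoly K[N.+1]})@_u *: G u].

(* Gaussian elimination in which the pivot of each new basis vector is a term
   of minimal weight. *)
Lemma pivot_basis_exists m (V : {vspace H m}) : exists U G, @pivot_basis m V U G.
Proof.
elim: {V}(\dim V) {-2}V (erefl (\dim V)) => [|r IHr] V Vr.
  exists [::], (fun=> 0); split=> // p; have /eqP -> : V == 0%VS by rewrite -dimv_eq0 Vr.
  by rewrite memv0 big_nil => /eqP.
have : vpick V != 0 by rewrite vpick0 -dimv_eq0 Vr.
have : vpick V \in V by exact: memv_pick.
move: (vpick V) => f fV; rewrite homog_eq0 => f0.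
have [u fu fw] := min_weight_attained v w f0.
have := @dim_coeff_kernel _ _ _ V u f fV fu; rewrite Vr => -[/esym].
set V' := (V :&: _)%VS; move=> V'r.
have mem_V' (p : H m) : (p \in V') = (p \in V) && (hcoeff u p == 0) by exact: mem_coeff_kernel.
have [U [G [Uu Us Gw Gd Gb]]] := IHr V' V'r.
have GV' y : y \in U -> (G y \in V) && ((G y : {mpoly K[N.+1]})@_u == 0).
  by move=> yU; rewrite -mem_V' (Gw y yU).1.
(* Reduction of [f] at the old pivots. The old basis vectors already vanish at [u], so the
   coefficient there is kept and they need no change. *)
pose f1 : H m := f - \sum_(y <- U) (f : {mpoly K[N.+1]})@_y *: G y.
have coef_f1 x : (f1 : {mpoly K[N.+1]})@_x =
    (f : {mpoly K[N.+1]})@_x - \sum_(y <- U) (f : {mpoly K[N.+1]})@_y * (G y : {mpoly K[N.+1]})@_x.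
  rewrite -[LHS]/(hcoeff x f1) linearB linear_sum /=; congr (_ - _).
  by apply: eq_bigr => y _; rewrite linearZ.
have f1u : (f1 : {mpoly K[N.+1]})@_u = (f : {mpoly K[N.+1]})@_u.
  by rewrite coef_f1 big_seq big1 ?subr0 // => y /GV'/andP[_ /eqP ->]; rewrite mulr0.
pose g : H m := ((f : {mpoly K[N.+1]})@_u)^-1 *: f1.
have coef_g x : (g : {mpoly K[N.+1]})@_x =
    ((f : {mpoly K[N.+1]})@_u)^-1 * (f1 : {mpoly K[N.+1]})@_x.
  by rewrite -[LHS]/(hcoeff x g) linearZ.
have gu : (g : {mpoly K[N.+1]})@_u = 1 by rewrite coef_g f1u mulVf.
have gU y : y \in U -> (g : {mpoly K[N.+1]})@_y = 0.
  move=> yU; rewrite coef_g coef_f1 (bigD1_seq y) //= Gd // eqxx mulr1.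
  rewrite big_seq_cond big1 ?addr0 ?subrr ?mulr0 // => x /andP[xU xy].
  by rewrite Gd // (negPf xy) mulr0.
have uU : u \notin U.
  apply: contraTN isT => uU; have /andP[_] := GV' u uU.
  by rewrite Gd // eqxx oner_eq0.
have gV : g \in V.
  rewrite memvZ // memvB // big_seq; apply: memv_suml => y yU; rewrite memvZ //.
  by case/andP: (GV' y yU).
(* Reducing [f] creates no term lighter than [mw f]: the coefficient of [f] at [y] and the weight
   [wt y] of [G y] together give at least [mw f]. So [u] remains a term of minimal weight. *)
have gw : mw g = wt u.
  rewrite -[RHS]add0r -(Defs.val1 v) -gu; apply: min_weightP; first by rewrite gu oner_neq0.
  move=> x gx; rewrite gu Defs.val1 add0r -lerBlDr.
  suff : val_ge v (wt u - wt x) (g : {mpoly K[N.+1]})@_x by rewrite val_geE.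
  have -> : wt u - wt x = - v (f : {mpoly K[N.+1]})@_u + (mw f - wt x) by rewrite fw; ring.
  rewrite coef_g; apply: val_geM; first by rewrite val_geE ?invr_neq0 // valV.
  rewrite coef_f1; apply: val_geD; first exact: val_ge_mcoeff.
  rewrite val_geN big_seq; apply: val_ge_sum => y yU.
  have -> : mw f - wt x = (mw f - wt y) + (wt y - wt x) by ring.
  by apply: val_geM; [exact: val_ge_mcoeff|rewrite -(Gw y yU).2; exact: val_ge_mcoeff].
have ne_u y : y \in U -> (y == u) = false by move=> yU; apply: contraNF uU => /eqP <-.
exists (u :: U), (fun y => if y == u then g else G y); split.
- by rewrite /= uU.
- by rewrite /= Us V'r Vr.
- move=> y; rewrite inE => /predU1P[->|yU]; first by rewrite eqxx.
  by rewrite ne_u //; split; [case/andP: (GV' y yU)|rewrite (Gw y yU).2].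
- move=> y z; rewrite !inE => /predU1P[->|yU] /predU1P[->|zU].
  + by rewrite eqxx gu.
  + by rewrite eqxx gU // eq_sym ne_u.
  + by rewrite ne_u // ; apply/eqP; case/andP: (GV' y yU).
  + by rewrite ne_u // Gd.
- move=> p pV; rewrite big_cons eqxx.
  have : p - (p : {mpoly K[N.+1]})@_u *: g \in V'.
    rewrite mem_V' (memvB pV (memvZ _ gV)) andTb linearB linearZ /= -[_ *: _]/(_ * _).
    by rewrite /hcoeff gu mulr1 subrr.
  move=> /Gb /eqP; rewrite subr_eq addrC => /eqP pE; rewrite {1}pE; congr (_ + _).
  rewrite !big_seq; apply: eq_bigr => y yU; rewrite ne_u //; congr (_ *: _).
  rewrite -[LHS]/(hcoeff y (p - _)) linearB linearZ /= -[_ *: _]/(_ * _).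
  by rewrite /hcoeff gU // mulr0 subr0.
Qed.

Definition pivots m (V : {vspace H m}) : seq 'X_{1..N.+1} := projT1 (cid (pivot_basis_exists V)).

Definition pivot_vector m (V : {vspace H m}) : 'X_{1..N.+1} -> H m :=
  projT1 (cid (projT2 (cid (pivot_basis_exists V)))).

Lemma pivotP m (V : {vspace H m}) : pivot_basis V (pivots V) (pivot_vector V).
Proof. exact: projT2 (cid (projT2 (cid (pivot_basis_exists V)))). Qed.

Definition initial_homog m (p : H m) : Hk m :=
  DHomog (initial_form_homog v t w (dhomog_is_dhomog p)).

Definition initial_comp m (V : {vspace H m}) : {vspace Hk m} :=
  <<[seq initial_homog (pivot_vector V u) | u <- pivots V]>>%VS.

Lemma mcoeff_initial_pivot m (V : {vspace H m}) u u' : u \in pivots V -> u' \in pivots V ->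
  (in_w (pivot_vector V u))@_u' = (u == u')%:R.
Proof.
have [_ _ Gw Gd _] := pivotP V => uU u'U.
rewrite mcoeff_initial_form (Gw u uU).2 Gd //; apply: (residue_at_delta ht).
by case: eqVneq => [->|_]; [left; rewrite subrr|right].
Qed.

(** The initial forms of the pivot basis are independent, their coefficients at the pivots forming
    an identity matrix; this is the equality of Hilbert functions. *)
Lemma dim_initial_comp m (V : {vspace H m}) : \dim (initial_comp V) = \dim V.
Proof.
have [Uu <- _ _ _] := pivotP V; set U := pivots V in Uu *.
rewrite /initial_comp -/U -(size_map (fun u => initial_homog (pivot_vector V u))).
apply/eqP; rewrite -[_ == _]/(free
  (map_tuple (fun u => initial_homog (pivot_vector V u)) (in_tuple U))).
apply/freeP => c c0 i.
have := congr1 (hcoeff (tnth (in_tuple U) i)) c0.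
rewrite linear0 linear_sum /= (bigD1 i) //= linearZ /= big1 => [|j ji].
  rewrite addr0 (nth_map 0%MM) ?ltn_ord // /hcoeff /= (tnth_nth 0%MM) /=.
  by rewrite mcoeff_initial_pivot ?mem_nth // eqxx -[_ *: _]/(_ * _) mulr1.
rewrite linearZ /= (nth_map 0%MM) ?ltn_ord // /hcoeff /= (tnth_nth 0%MM) /=.
by rewrite mcoeff_initial_pivot ?mem_nth // nth_uniq // val_eqE (negPf ji) scaler0.
Qed.

(** The expansion of [p] in the pivot basis meets the weight condition of [initial_form_sum]; so the
    span of finitely many initial forms misses none. *)
Lemma initial_homog_mem m (V : {vspace H m}) (p : H m) :
  p \in V -> p != 0 -> initial_homog p \in initial_comp V.
Proof.
have [_ _ Gw _ Gb] := pivotP V => pV p0; set G := pivot_vector V in Gw Gb *.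
have pE : (p : {mpoly K[N.+1]}) = \sum_(u <- pivots V)
    (p : {mpoly K[N.+1]})@_u *: (G u : {mpoly K[N.+1]}).
  by rewrite {1}(Gb p pV) raddf_sum.
have ge u : u \in pivots V -> val_ge v (mw p - mw (G u)) (p : {mpoly K[N.+1]})@_u.
  by move=> uU; rewrite (Gw u uU).2 val_ge_mcoeff.
rewrite [X in X \in _](_ : _ = \sum_(u <- pivots V)
    residue_at v t (mw p - mw (G u)) (p : {mpoly K[N.+1]})@_u *: initial_homog (G u)).
  rewrite big_seq memv_suml // => u uU.
  by apply/memvZ/memv_span/mapP; exists u.
apply: val_inj; rewrite /= (initial_form_sum ht pE ge) raddf_sum.
by apply: eq_bigr.
Qed.

Lemma initial_comp_graded (W : forall m, {vspace H m}) :
  graded W -> graded (fun m => initial_comp (W m)).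
Proof.
move=> gW m i; suff /subvP sub :
    (initial_comp (W m) <= hmul 'X_i m m.+1 @^-1: initial_comp (W m.+1))%VS.
  by move=> p /sub; rewrite memv_preim.
apply/span_subvP => _ /mapP[u uU ->]; rewrite -memv_preim.
have [_ _ Gw Gd _] := pivotP (W m); set G := pivot_vector (W m) u.
have G0 : (G : {mpoly K[N.+1]}) != 0.
  apply/eqP => e; have /esym/eqP := Gd u u uU uU.
  by rewrite -/G e mcoeff0 eqxx -[_%:R]/(1 : K) oner_eq0.
have XG := hmulE G (mpolyX_dhomog K i) (add1n m).
rewrite [X in X \in _](_ : _ = initial_homog (hmul 'X_i m m.+1 G)).
  apply: initial_homog_mem; first exact: gW _ _ _ (Gw u uU).1.
  by rewrite homog_eq0 XG mulf_neq0 // -msupp_eq0 msuppX.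
apply: val_inj; rewrite [LHS](hmulE _ (mpolyX_dhomog _ i)) ?add1n //= XG.
by rewrite mulrC -initial_formMX // mulrC.
Qed.

End InitialComponents.

(** * Ideals generated by a set *)

Section IdealGen.
Variable A : comNzRingType.
Implicit Types (S J : set A) (p q : A).

Lemma ideal_gen_mem S p : S p -> ideal_gen S p.
Proof.
by move=> Sp; exists 1%N, (fun=> 1), (fun=> p); rewrite big_ord1 mul1r.
Qed.

Lemma ideal_gen0 S : ideal_gen S 0.
Proof.
by exists 0%N, (fun=> 0), (fun=> 0); rewrite big_ord0; split=> // -[].
Qed.

Lemma ideal_genD S p q : ideal_gen S p -> ideal_gen S q -> ideal_gen S (p + q).
Proof.
move=> [m [a [s [sS ->]]]] [m' [a' [s' [s'S ->]]]].
exists (m + m')%N, (fun i => match split i with inl j => a j | inr j => a' j end),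
  (fun i => match split i with inl j => s j | inr j => s' j end); split.
  by move=> i; case: split.
rewrite big_split_ord /=; congr (_ + _); apply: eq_bigr => i _.
  by rewrite (unsplitK (inl i)).
by rewrite (unsplitK (inr i)).
Qed.

Lemma ideal_genM S p q : ideal_gen S q -> ideal_gen S (p * q).
Proof.
move=> [m [a [s [sS ->]]]]; exists m, (fun i => p * a i), s; split=> //.
by rewrite mulr_sumr; apply: eq_bigr => i _; rewrite mulrA.
Qed.

Lemma ideal_gen_sum S (I : eqType) (r : seq I) (F : I -> A) :
  (forall i, i \in r -> ideal_gen S (F i)) -> ideal_gen S (\sum_(i <- r) F i).
Proof.
elim: r => [|i r IH] Fr; first by rewrite big_nil; exact: ideal_gen0.
rewrite big_cons; apply: ideal_genD; first by apply: Fr; rewrite mem_head.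
by apply: IH => j jr; apply: Fr; rewrite inE jr orbT.
Qed.

Lemma ideal_gen_sub S S' p : (forall q, S q -> ideal_gen S' q) -> ideal_gen S p -> ideal_gen S' p.
Proof.
move=> SS' [m [a [s [sS ->]]]]; apply: ideal_gen_sum => i _.
exact/ideal_genM/SS'.
Qed.

End IdealGen.

Section Generation.
Variables (N : nat) (F : fieldType).
Local Notation H := (dhomog N.+1 F).

Lemma graded_mulX (W : forall m, {vspace H m}) u a b (p : H a) : graded W ->
  (mdeg u + a)%N = b -> p \in W a -> hmul 'X_[u] a b p \in W b.
Proof.
move=> gW + pW; have [d] := ubnP (mdeg u); elim: d u b => // d IHd u b ud uab.
have Xu (x : 'X_{1..N.+1}) : ('X_[x] : {mpoly F[N.+1]}) \is (mdeg x).-homog by rewrite dhomogX.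
have [u0|/mnm_neq0[i ui]] := eqVneq u 0%MM.
  rewrite u0 mdeg0 add0n in uab *; rewrite -uab.
  have -> // : hmul 'X_[0] a a p = p.
  by apply: val_inj; rewrite [LHS](hmulE _ (Xu _)) ?mdeg0 // mpolyX0 mul1r.
have le_u : (U_(i) <= u)%MM by rewrite lep1mP.
have uE : (mdeg (u - U_(i))%MM).+1 = mdeg u by rewrite -{2}(submK le_u) mdegD mdeg1 addn1.
case: b uab => [|b] uab; first by rewrite -uE in uab.
have ub : (mdeg (u - U_(i))%MM + a)%N = b by rewrite -uE in uab; case: uab.
have -> : hmul 'X_[u] a b.+1 p = hmul 'X_i b b.+1 (hmul 'X_[u - U_(i)] a b p).
  apply: val_inj; rewrite [LHS](hmulE _ (Xu _)) // [RHS](hmulE _ (mpolyX_dhomog _ i)) ?add1n //.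
  by rewrite (hmulE _ (Xu _)) // mulrA -mpolyXD addmC submK.
by apply: gW; apply: IHd => //; rewrite -ltnS uE.
Qed.

(** Division by elements of degree at most [D]: a monomial multiple of one of them cancels the
    leading term of [p], and the monomial order is well-founded. *)
Lemma graded_generation (W : forall m, {vspace H m}) (S : set {mpoly F[N.+1]}) D :
  graded W ->
  (forall u, leads W u -> exists v, [/\ leads W v, (v <= u)%MM & (mdeg v <= D)%N]) ->
  (forall m (p : H m), (m <= D)%N -> p \in W m -> ideal_gen S (p : {mpoly F[N.+1]})) ->
  forall m (p : H m), p \in W m -> ideal_gen S (p : {mpoly F[N.+1]}).
Proof.
move=> gW gen low m p; move: {-1}(mlead p) (erefl (mlead p)) => u.
elim: (ltom_wf u) p => {}u _ IH p pu pW.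
have [->|p0] := eqVneq (p : {mpoly F[N.+1]}) 0; first exact: ideal_gen0.
have um : mdeg u = m by apply: (dhomog_mf (dhomog_is_dhomog p)); rewrite -pu mlead_supp.
have lu : leads W u.
  by rewrite /leads; move: (mdeg u) um => m' m'E; subst m'; apply/asboolP; exists p.
have [x [lx xu xD]] := gen u lu.
case/asboolP: lx => q qW [q0 qx]; have Xdeg : (mdeg (u - x)%MM + mdeg x)%N = m.
  by rewrite -mdegD submK.
pose r := hmul 'X_[u - x] (mdeg x) m q; have rW : r \in W m by exact: graded_mulX.
have rE : (r : {mpoly F[N.+1]}) = 'X_[u - x] * q by rewrite (hmulE _ _ Xdeg) // dhomogX.
have ru : (r : {mpoly F[N.+1]})@_u = (q : {mpoly F[N.+1]})@_x.
  by rewrite rE mulrC; have := mcoeffMX (q : {mpoly F[N.+1]}) (u - x)%MM x; rewrite submK.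
have qx0 : (q : {mpoly F[N.+1]})@_x != 0 by rewrite -[X in _@_X]qx mleadc_eq0.
have r0 : (r : {mpoly F[N.+1]}) != 0 by apply: contraNneq qx0 => e; rewrite -ru e mcoeff0.
have r_lead : (mlead r <= u)%O.
  by rewrite rE (le_trans (mleadM_le _ _)) // mleadXm qx submK.
pose c := (p : {mpoly F[N.+1]})@_u / (q : {mpoly F[N.+1]})@_x.
have Jr : ideal_gen S (c *: (r : {mpoly F[N.+1]})).
  by rewrite rE scalerAl; apply: ideal_genM; exact: low xD qW.
rewrite -(subrK (c *: (r : {mpoly F[N.+1]})) (p : {mpoly F[N.+1]})); apply: ideal_genD => //.
have [s0|s0] := eqVneq ((p : {mpoly F[N.+1]}) - c *: (r : {mpoly F[N.+1]})) 0.
  by rewrite s0; exact: ideal_gen0.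
apply: (IH _ _ (p - c *: r) (erefl _)); last by rewrite memvB // memvZ.
rewrite /= lt_neqAle; apply/andP; split.
  apply: contraNneq s0 => e; rewrite -mleadc_eq0 e mcoeffB mcoeffZ ru /c divfK //.
  by rewrite subrr.
apply: le_trans (mleadB_le _ _) _; rewrite leUx -pu lexx /=.
by apply: le_trans (mleadZ_le _ _) _; rewrite pu.
Qed.

End Generation.

(** * Groebner bases *)

Section Components.
Variables (n : nat) (F : fieldType).
Implicit Types (p f a : {mpoly F[n]}).

Lemma mcoeff_pihomog m p u : (pihomog mdeg m p)@_u = if mdeg u == m then p@_u else 0.
Proof.
have [um|um] := eqVneq (mdeg u) m; last exact: dhomog_nemf_coeff (pihomogP mdeg m p) um.
pose k := maxn (msize p) (mdeg u).+1.
have pE := @pihomog_partitionE _ _ mdeg k p (leq_maxl _ _).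
transitivity ((\sum_(i < k) pihomog mdeg i p)@_u); last by rewrite -pE.
rewrite [RHS]raddf_sum /=.
have mk : (m < k)%N by rewrite -um leq_maxr.
rewrite (bigD1 (Ordinal mk)) //= big1 ?addr0 // => i im.
apply: dhomog_nemf_coeff (pihomogP mdeg i p) _.
by apply: contraNneq im => e; apply/eqP/val_inj; rewrite /= -um -e.
Qed.

Lemma pihomogM f e m a : f \is e.-homog ->
  pihomog mdeg m (f * a) = if (e <= m)%N then f * pihomog mdeg (m - e) a else 0.
Proof.
move=> fe; pose k := maxn (msize a) (m - e).+1.
rewrite {1}(@pihomog_partitionE _ _ mdeg k a) ?leq_maxl // mulr_sumr raddf_sum /=.
have fa i : f * pihomog mdeg i a \is (e + i).-homog by apply: dhomogM => //; exact: pihomogP.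
case: leqP => em.
  have mk : (m - e < k)%N by rewrite leq_maxr.
  rewrite (bigD1 (Ordinal mk)) //= pihomog_dE ?big1 ?addr0 //; last first.
    by have := fa (m - e)%N; rewrite subnKC.
  move=> i im; apply: pihomog_ne0 (fa i); apply: contraNneq im => e'.
  by apply/eqP/val_inj; rewrite /= -e' addKn.
rewrite big1 // => i _; apply: pihomog_ne0 (fa i).
by rewrite gtn_eqF // (leq_trans em) // leq_addr.
Qed.

Lemma mpdeg_homog f : f \is homog mdeg -> f \is (mpdeg f).-homog.
Proof. by []. Qed.

Lemma dhomog_mpdeg p m : p != 0 -> p \is m.-homog -> mpdeg p = m.
Proof.
move=> p0 /dhomog_mf pm; rewrite /mpdeg -mlead_deg //=.
exact/pm/mlead_supp.
Qed.

End Components.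

Section GeneratedIdeal.
Variables (N : nat) (F : fieldType).
Local Notation H := (dhomog N.+1 F).
Implicit Types (fs : seq {mpoly F[N.+1]}) (S : set {mpoly F[N.+1]}).

Definition homog_part m (p : {mpoly F[N.+1]}) : H m := DHomog (pihomogP mdeg m p).

Lemma gen_comp_sub fs S m (p : H m) : all (@homog_nz N F) fs -> (forall f, f \in fs -> S f) ->
  p \in gen_comp fs m -> ideal_gen S (p : {mpoly F[N.+1]}).
Proof.
move=> fsP fsS; elim: fs fsP fsS p => [_ _ p|f fs IH /= /andP[/andP[f0 fe] fsP] fsS p].
  by rewrite memv0 => /eqP ->; exact: ideal_gen0.
case/memv_addP => p1 p1J [p2 p2J ->]; apply: ideal_genD.
  by apply: IH => // g gfs; apply: fsS; rewrite inE gfs orbT.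
move: p2J; case: leqP => [fm|_]; last by rewrite memv0 => /eqP ->; exact: ideal_gen0.
case/memv_imgP => q _ ->; rewrite [X in ideal_gen S X](hmulE _ fe) ?subnKC // mulrC.
by apply/ideal_genM/ideal_gen_mem/fsS; rewrite mem_head.
Qed.

Lemma homog_part_mem fs S m p : all (@homog_nz N F) fs ->
  (forall f, S f -> f = 0 \/ f \in fs) -> ideal_gen S p -> homog_part m p \in gen_comp fs m.
Proof.
move=> fsP Sfs [l [a [s [sS ->]]]].
have -> : homog_part m (\sum_(i < l) a i * s i) = \sum_(i < l) homog_part m (a i * s i).
  by apply: val_inj; rewrite /= !raddf_sum.
apply: memv_suml => i _; have [si0|sfs] := Sfs _ (sS i).
  rewrite si0 mulr0 (_ : homog_part m 0 = 0) ?mem0v //.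
  by apply: val_inj; rewrite /= pihomog0.
have /andP[s0 se] := allP fsP _ sfs.
have E : val (homog_part m (a i * s i)) =
    if (mpdeg (s i) <= m)%N then s i * pihomog mdeg (m - mpdeg (s i)) (a i) else 0.
  by rewrite /= mulrC (pihomogM _ _ se).
case: leqP E => [sm E|_ E].
  by apply: (gen_comp_mul (f := s i) (q := homog_part (m - mpdeg (s i)) (a i))) => //; apply/andP.
by rewrite (_ : homog_part _ _ = 0) ?mem0v //; exact: val_inj.
Qed.

End GeneratedIdeal.

Section GroebnerBasis.
Variables (R : realType) (K : fieldType) (v : valuation R K) (t : R -> K).
Hypothesis ht : splitting v t.
Variables (N : nat) (w : 'rV[R]_N.+1).
Local Notation k := (residue_field v).
Local Notation in_w := (initial_form v t w).
Local Notation Hk := (dhomog N.+1 (residue_field v)).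
Variables (fs : seq {mpoly K[N.+1]}) (S : set {mpoly K[N.+1]}).
Hypothesis fsP : all (@homog_nz N K) fs.
Hypothesis fsS : forall f, f \in fs -> S f.
Hypothesis Sfs : forall f, S f -> f = 0 \/ f \in fs.
Let W m := gen_comp fs m.
Let Wk m : {vspace Hk m} := initial_comp v t w (W m).

(** Not minimal: whole pivot bases are taken in all degrees up to [D], so that the initial forms
    span these components. *)
Definition pivot_vectors D : seq {mpoly K[N.+1]} :=
  [seq (pivot_vector v w (gen_comp fs m) u : {mpoly K[N.+1]}) |
    m <- iota 0 D.+1, u <- pivots v w (gen_comp fs m)].

Lemma pivot_vectorsP D p : p \in pivot_vectors D ->
  [/\ ideal_gen S p, p != 0 & exists2 m, (m <= D)%N & p \is m.-homog].
Proof.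
case/allpairsPdep => m [u [mD uU ->]]; have [_ _ Gw Gd _] := pivotP v w (gen_comp fs m).
split.
- exact: gen_comp_sub fsP fsS (Gw u uU).1.
- apply/eqP => e; have /esym/eqP := Gd u u uU uU.
  by rewrite e mcoeff0 eqxx -[_%:R]/(1 : K) oner_eq0.
- by exists m; [move: mD; rewrite mem_iota|exact: dhomog_is_dhomog].
Qed.

Lemma groebner_basis_pivot_vectors D :
  (forall u, leads Wk u -> exists x, [/\ leads Wk x, (x <= u)%MM & (mdeg x <= D)%N]) ->
  groebner_basis v t w (ideal_gen S) (pivot_vectors D).
Proof.
move=> gen; split=> [p /pivot_vectorsP[Ip p0 [m _ pm]]|].
  by split=> //; apply/homogP; exists m.
set S2 := [set in_w p | p in [set p | p \in pivot_vectors D]]%classic.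
have gW : graded W by exact: gen_comp_graded.
have low m (p : Hk m) : (m <= D)%N -> p \in Wk m -> ideal_gen S2 (p : {mpoly k[N.+1]}).
  move=> mD /(@coord_span _ _ _ (in_tuple _)) ->; rewrite raddf_sum.
  apply: ideal_gen_sum => i _; rewrite -[X in ideal_gen _ X]mul_mpolyC; apply: ideal_genM.
  apply: ideal_gen_mem; set X := map _ _.
  have : X`_i \in X by rewrite mem_nth // ltn_ord.
  case/mapP => u uU ->; exists (pivot_vector v w (W m) u : {mpoly K[N.+1]}) => //=.
  by apply/allpairsPdep; exists m, u; rewrite mem_iota.
have all_in := graded_generation (initial_comp_graded ht gW) gen low.
apply/seteqP; split=> q; apply: ideal_gen_sub => {}q [f /= fP <-]; last first.
  by apply: ideal_gen_mem; have [If f0 _] := pivot_vectorsP fP; exists f.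
have [If f0] := fP.
(* The initial ideal also involves inhomogeneous [f]. The pivot expansions of all components of [f]
   are combined, and the weight condition still holds because each coefficient is one of [f]. *)
pose s := [seq (m, u) | m <- iota 0 (msize f), u <- pivots v w (W m)].
pose c (x : nat * 'X_{1..N.+1}) := (pihomog mdeg x.1 f)@_x.2.
pose G (x : nat * 'X_{1..N.+1}) : {mpoly K[N.+1]} := pivot_vector v w (W x.1) x.2.
have fE : f = \sum_(x <- s) c x *: G x.
  have iotaE : iota 0 (msize f) = index_iota 0 (msize f) by rewrite /index_iota subn0.
  rewrite big_allpairs_dep /= iotaE big_mkord.
  rewrite {1}(@pihomog_partitionE _ _ mdeg _ f (leqnn _)); apply: eq_bigr => m _.
  have [_ _ _ _ Gb] := pivotP v w (W m).
  rewrite -[LHS]/(val (homog_part m f)) {1}(Gb (homog_part m f)) ?raddf_sum //.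
  exact: homog_part_mem fsP Sfs If.
have sP x : x \in s -> x.2 \in pivots v w (W x.1) by case/allpairsPdep => m [u [_ uU ->]].
rewrite (initial_form_sum ht fE) => [|x /sP xs]; last first.
  have [_ _ Gw _ _] := pivotP v w (W x.1); rewrite (Gw _ xs).2 /c mcoeff_pihomog.
  by case: eqP => _; [exact: val_ge_mcoeff|exact: val_ge0].
apply: ideal_gen_sum => x /sP xs; rewrite -mul_mpolyC; apply: ideal_genM.
have [_ _ Gw Gd _] := pivotP v w (W x.1).
apply: (all_in x.1 (initial_homog v t w (pivot_vector v w (W x.1) x.2))).
apply: initial_homog_mem => //; first exact: (Gw _ xs).1.
rewrite homog_eq0; apply/eqP => e; have /esym/eqP := Gd _ _ xs xs.
by rewrite e mcoeff0 eqxx -[_%:R]/(1 : K) oner_eq0.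
Qed.

End GroebnerBasis.

Local Open Scope classical_set_scope.

(** * Degenerate cases: zero ideal and unit ideal *)

Section DegreeZero.
Variables (R : realType) (K : fieldType) (v : valuation R K) (t : R -> K).
Variables (n : nat) (w : 'rV[R]_n).
Implicit Types (S : set {mpoly K[n]}) (f : {mpoly K[n]}).

Lemma groebner_basis_nil S : (forall f, S f -> f = 0) ->
  groebner_basis v t w (ideal_gen S) [::].
Proof.
move=> S0; split=> //; apply/seteqP; split=> q; apply: ideal_gen_sub => {}q [f] //.
case=> If f0 _.
have [m [a [s [sS fE]]]] := If; case/eqP: f0.
by rewrite fE big1 // => i _; rewrite (S0 _ (sS i)) mulr0.
Qed.

Lemma groebner_basis_const (ht : splitting v t) S f : S f -> f != 0 -> f \is 0.-homog ->
  groebner_basis v t w (ideal_gen S) [:: f].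
Proof.
move=> Sf f0 fh; split=> [p|].
  rewrite inE => /eqP ->; split=> //; first exact: ideal_gen_mem.
  by apply/homogP; exists 0%N.
have If := ideal_gen_mem Sf.
apply/seteqP; split=> q; last first.
  apply: ideal_gen_sub => {}q [p /= + <-]; rewrite inE => /eqP ->.
  by apply: ideal_gen_mem; exists f.
have g0 := initial_form_neq0 ht w f0; have gh := initial_form_homog v t w fh.
(* The initial form is a nonzero constant, hence a unit. *)
have /msize_poly1P[c c0 gE] : msize (initial_form v t w f) == 1%N.
  by rewrite -mlead_deg // (dhomog_mf gh) // mlead_supp.
move=> _; rewrite -[q]mulr1 -(mpolyC1 n) -(mulVf c0) mpolyCM -gE mulrA.
by apply/ideal_genM/ideal_gen_mem; exists f; rewrite //= mem_head.
Qed.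

End DegreeZero.

Lemma cone_hilb_shift (d u : nat) : shifted_hilb (d, u.+1) d = 1%N.
Proof. by rewrite /shifted_hilb /= leqnn subnn add0n binn. Qed.

Unset Implicit Arguments.

Theorem theorem3p1 (R : realType) (K : fieldType) (v : valuation R K)
    (t : R -> K) (ht : splitting v t) (n l d : nat)
    (f : 'I_l -> {mpoly K[n]})
    (f_homog : forall i, f i \is homog mdeg)
    (f_deg : forall i, (mpdeg (f i) <= d)%N)
    (I : set {mpoly K[n]}) (hI : I = ideal_gen (range f))
    (w : 'rV[R]_n) :
  exists g : seq {mpoly K[n]},
    groebner_basis v t w I g /\
    forall p, p \in g ->
      (mpdeg p)%:R <=
        2 * (d%:R ^+ 2 / 2 + d%:R) `^ (2 `^ (n%:R - 2)) :> R.
Proof.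
rewrite hI; have [[i fi0]|f0] := EM (exists i, f i != 0); last first.
  exists [::]; split=> //; apply: groebner_basis_nil => _ [i _ <-].
  by apply/eqP; apply: contra_notT f0 => fi0; exists i.
have [d0|d_gt0] := posnP d.
  have fi : f i \is 0.-homog.
    have fi_deg : mpdeg (f i) = 0%N by apply/eqP; rewrite -leqn0 -d0.
    by have := mpdeg_homog (f_homog i); rewrite fi_deg.
  exists [:: f i]; split; first by apply: groebner_basis_const => //; exists i.
  move=> p; rewrite inE => /eqP ->; rewrite (dhomog_mpdeg fi0 fi).
  by rewrite mulr_ge0 ?ler0n ?powR_ge0.
case: n => [|N] in f f_homog f_deg I hI w i fi0 *.
  have fi : f i \is 0.-homog.
    by apply/dhomogP => m _; rewrite /= mdegE big_ord0.
  exists [:: f i]; split; first by apply: groebner_basis_const => //; exists i.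
  move=> p; rewrite inE => /eqP ->; rewrite (dhomog_mpdeg fi0 fi).
  by rewrite mulr_ge0 ?ler0n ?powR_ge0.
(* Zero generators are discarded, since multiplication by a generator has to be injective. *)
pose fs := [seq f j | j <- enum 'I_l & f j != 0].
have fsP : all (@homog_nz N K) fs.
  apply/allP => _ /mapP[j + ->]; rewrite mem_filter => /andP[fj _].
  by rewrite /homog_nz fj; exact: f_homog.
have fsd : all (fun g => mpdeg g <= d)%N fs by apply/allP => _ /mapP[j _ ->].
have fsS g : g \in fs -> range f g by case/mapP => j _ ->; exists j.
have Sfs g : range f g -> g = 0 \/ g \in fs.
  case=> j _ <-; have [->|fj] := eqVneq (f j) 0; [by left|right].
  by apply/mapP; exists j; rewrite // mem_filter fj mem_enum.
have fi_fs : f i \in fs by apply/mapP; exists i; rewrite // mem_filter fi0 mem_enum.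
have [fs' [f1 fsE]] : exists fs' f1, fs = rcons fs' f1.
  by case: (lastP fs) fi_fs => // fs' f1 _; exists fs', f1.
have := fsP; have := fsd; rewrite fsE !all_rcons => /andP[f1d fsd'] /andP[f1P fsP'].
have [P] := gen_comp_cones fsP' f1P fsd' f1d; rewrite -fsE => -[P1 P2 P3].
pose Wk m := initial_comp v t w (gen_comp fs m).
have gWk : graded Wk by apply: initial_comp_graded => //; exact: gen_comp_graded.
have [Q [Q1 Q2 Q3 Q4]] := graded_cones gWk.
have dimWk m : \dim (Wk m) = (shifted_hilb (d, N.+1) m + hilb P m)%N.
  by rewrite dim_initial_comp.
have {}Q3 (c : nat * nat) : c \in Q -> (c.2 <= N)%N.
  (* The full cone starts in degree [d], so the initial ideal is nonzero there. *)
  by apply: Q3; exists d; rewrite -dimv_eq0 dimWk cone_hilb_shift.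
have [|D [QD D_le]] := @dube_bound R N d P Q d_gt0 P1 P2 Q1 Q3.
  by move=> z; rewrite -Q2 dimWk.
exists (pivot_vectors v w fs D); split.
  apply: groebner_basis_pivot_vectors => // u /Q4[x [lx xu xQ]]; exists x; split=> //.
  (* A minimal leading monomial may exceed the degree of a cone by one, which is absorbed because
     [D] is strictly larger than all cone degrees. *)
  by case: xQ => [->|[c /QD cD xc]]; [rewrite mdeg0|exact: leq_trans xc cD].
move=> p /(pivot_vectorsP fsP fsS)[_ p0 [m mD pm]].
by rewrite (dhomog_mpdeg p0 pm); apply: le_trans D_le; rewrite ler_nat.
Qed.
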